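(* Let $n\ge2$, let $\check{\mathcal Q}_{B_n}=\{\mathbf x\in\mathbb Z^n:\sum x_i\equiv0\bmod2\}$ be the type $B_n$ coroot lattice, and let $\iota:\check{\mathcal Q}_{B_n}\to\check{\mathcal Q}_{2n}$, $\iota(x_1,\dots,x_n)=(x_1,\dots,x_n,-x_n,\dots,-x_1)$. The map $\mathbf x\mapsto\lambda_{\iota(\mathbf x)}$ is a $\widetilde W(B_n)$-equivariant bijection between $\check{\mathcal Q}_{B_n}$ and the set of self-conjugate $2n$-cores with an even number of boxes on the main diagonal. For $\mathbf x\in\check{\mathcal Q}_{B_n}$, writing $\lambda=\lambda_{\iota(\mathbf x)}$, $$\check{\mathrm{size}}_i(\mathbf x)=\frac12\begin{cases}\mathrm{size}_i(\lambda)+\mathrm{size}_{2n-i}(\lambda)&\text{if }1<i\le n,\\ \mathrm{size}_1(\lambda)+\mathrm{size}_{2n-1}(\lambda)-\mathrm{size}_0(\lambda)&\text{if }i=1,\\ \mathrm{size}_0(\lambda)&\text{if }i=0,\end{cases}$$ and hence $\check{\mathrm{size}}(\mathbf x)=\frac12\big(\mathrm{size}(\lambda)-\mathrm{size}_0(\lambda)\big)$.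
   Context: Partitions and cores. For $m\ge2$ an $m$-core is an integer partition with no hook of length $m$. Let $\check{\mathcal Q}_m=\{q\in\mathbb Z^m:\sum q_j=0\}$. For $q\in\check{\mathcal Q}_m$, define a bi-infinite word with positions $p\in\mathbb Z$: write $p=m(\ell-1)+j$ with $\ell\in\mathbb Z$, $1\le j\le m$, and put $\bullet$ at position $p$ if $\ell\le q_j$, and $\circ$ otherwise. Reading the word in increasing $p$ with $\bullet$ an up-step and $\circ$ a right-step traces, from bottom left to top right, the boundary of a unique partition (English notation); this is $\lambda_q$. (Its parts are the nonzero numbers $\#\{p'<p:\ p'\text{ is }\circ\}$ over positions $p$ carrying $\bullet$.) The map $q\mapsto\lambda_q$ is a bijection from $\check{\mathcal Q}_m$ to $m$-cores. The content of the box in row $u$, column $v$ is $v-u$; $\mathrm{size}_i(\lambda)$ is the number of boxes of $\lambda$ with content $\equiv i$ mod $m$ (here $m=2n$), and $\mathrm{size}(\lambda)$ is the total number of boxes. The affine symmetric group $\widetilde{\mathfrak S}_m$ acts on $\check{\mathcal Q}_m$: $s_i^A$ ($1\le i<m$) swaps coordinates $i,i+1$, and $s_0^A(q_1,\dots,q_m)=(q_m+1,q_2,\dots,q_{m-1},q_1-1)$. It acts on $m$-cores by letting $s_i^A$ add all addable boxes of content $i$ mod $m$, or remove all removable boxes of content $i$ mod $m$. Type $B_n$. Simple roots $\alpha_i=e_i-e_{i+1}$ for $1\le i<n$, $\alpha_n=e_n$ in $\mathbb R^n$ with the standard inner product. The affine Weyl group $\widetilde W(B_n)$ acts on $\check{\mathcal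 Q}_{B_n}$ by: $s_i$ swaps $x_i,x_{i+1}$ for $1\le i<n$; $s_n$ negates $x_n$; $s_0(x_1,x_2,x_3,\dots,x_n)=(1-x_2,1-x_1,x_3,\dots,x_n)$. On the self-conjugate $2n$-cores with an even number of diagonal boxes it acts by $s_i\mapsto s_i^As_{2n-i}^A$ for $1\le i<n$, $s_n\mapsto s_n^A$, $s_0\mapsto s_0^As_1^As_{2n-1}^As_0^A$. Define $\check{\mathrm{size}}_i(\mathbf x)=\langle\frac{c_i}2\mathbf x-\check\omega_i,\mathbf x\rangle$ for $0\le i\le n$ and $\check{\mathrm{size}}=\sum_{i=0}^n\check{\mathrm{size}}_i$, where $\check\omega_0=0$, $\check\omega_i=e_1+\dots+e_i$ ($1\le i\le n$) is the basis dual to the simple roots, $c_0=1$, and $c_i$ are the coefficients of the highest root $e_1+e_2$ in simple roots ($c_1=1$, $c_i=2$ for $2\le i\le n$).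
   Formalization: The final total is corrected to ½(size(λ) − size_0(λ) + size_n(λ)), since the i = n formula contributes size_n(λ) in full; as printed it fails for n = 2, x = (−1,−1), λ = (4,4,2,2), where the total is 7 and not 5. *)

(* Defs.v *)
From HB Require Import structures.
From mathcomp Require Export all_boot all_order all_algebra.
From mathcomp Require Export classical_sets functions.
From mathcomp Require Import zify ring lra.
Set Implicit Arguments.
Unset Strict Implicit.
Unset Printing Implicit Defensive.
Import Order.TTheory GRing.Theory Num.Theory.
Local Open Scope ring_scope.

(** Integer partitions: weakly decreasing lists of positive parts.  Rows and
    columns are numbered from 0; contents and hook lengths are unaffected. *)

Definition is_partition (s : seq nat) : bool := sorted geq s && (0%N \notin s).

Definition boxes (s : seq nat) : seq (nat * nat) :=
  [seq (u, v) | u <- iota 0 (size s), v <- iota 0 (nth 0%N s u)].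

Definition psize (s : seq nat) : nat := size (boxes s).

Definition content (b : nat * nat) : int := b.2%:Z - b.1%:Z.

Definition has_residue (m i : nat) (b : nat * nat) : bool :=
  (content b == i%:Z %[mod m%:Z])%Z.

Definition size_res (m i : nat) (s : seq nat) : nat :=
  count (has_residue m i) (boxes s).

Definition diag_size (s : seq nat) : nat := count (fun b => b.1 == b.2) (boxes s).

Definition conj_part (s : seq nat) : seq nat :=
  [seq count (fun r => v < r)%N s | v <- iota 0 (head 0%N s)].

Definition hook_length (s : seq nat) (b : nat * nat) : nat :=
  ((nth 0 s b.1 - b.2.+1) + (nth 0 (conj_part s) b.2 - b.1.+1) + 1)%N.

Definition is_core (m : nat) (s : seq nat) : bool :=
  is_partition s && all (fun b => hook_length s b != m) (boxes s).

(** Row [u <= size s] has at most one addable box, [(u, s_u)], and at most one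
    removable box, [(u, s_u - 1)]; in [row_removable] the inequality forces
    [0 < s_u]. *)

Definition row_addable (m i : nat) (s : seq nat) (u : nat) : bool :=
  ((u == 0) || (nth 0 s u < nth 0 s u.-1))%N && has_residue m i (u, nth 0%N s u).

Definition row_removable (m i : nat) (s : seq nat) (u : nat) : bool :=
  (nth 0 s u.+1 < nth 0 s u)%N && has_residue m i (u, (nth 0%N s u).-1).

(** The generator [s_i^A] on partitions.  An [m]-core never has both an addable
    and a removable box of the same residue, so the order of the two tests is
    immaterial on cores. *)

Definition core_sA (m i : nat) (s : seq nat) : seq nat :=
  let rows := iota 0 (size s).+1 in
  [seq r <- if has (row_addable m i s) rows
            then [seq (nth 0 s u + row_addable m i s u)%N | u <- rows]
            else [seq (nth 0 s u - row_removable m i s u)%N | u <- rows]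
   | (0 < r)%N].

(** [coord x k] is the coordinate [x_{k+1}] of [x = (x_1, ..., x_m)], and [0]
    when [k >= m]. *)

Definition coord (m : nat) (x : 'rV[int]_m) (k : nat) : int :=
  oapp (fun j : 'I_m => x ord0 j) 0 (insub k).

(** The word of [q]: [bead q p] says that position [p] carries a bullet.  Writing
    [p = m (l - 1) + j] with [1 <= j <= m], we have [l - 1 = (p - 1) %/ m] and
    [j - 1 = (p - 1) %% m]. *)

Definition bead (m : nat) (q : 'rV[int]_m) (p : int) : bool :=
  ((p - 1) %/ m%:Z)%Z + 1 <= coord q `|((p - 1) %% m%:Z)%Z|%N.

Definition bead_bound (m : nat) (q : 'rV[int]_m) : nat :=
  (m * \max_(j < m) `|q ord0 j|)%N.

(** The word is constant outside of [- bead_bound q < p <= bead_bound q], so that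
    only positions in this window matter for [lam] below. *)

Lemma coord_bound (m : nat) (q : 'rV[int]_m) (k : nat) :
  (`|coord q k| <= \max_(j < m) `|q ord0 j|)%N.
Proof.
rewrite /coord; case: insubP => [j _ _|_] //=.
exact: (leq_bigmax (F := fun j => `|q ord0 j|%N)).
Qed.

Lemma bead_low (m : nat) (q : 'rV[int]_m) (p : int) :
  (0 < m)%N -> p <= - (bead_bound q)%:Z -> bead q p.
Proof.
move=> m_gt0; rewrite /bead_bound /bead.
have := coord_bound q `|((p - 1) %% m%:Z)%Z|%N.
move: (coord q _) (\max_(_ < _) _)%N => c M cM pM.
have: ((p - 1) %/ m%:Z)%Z < - M%:Z.
  by rewrite ltz_divLR ?ltz_nat //; move: pM; rewrite PoszM; lia.
by move: cM; lia.
Qed.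

Lemma bead_high (m : nat) (q : 'rV[int]_m) (p : int) :
  (0 < m)%N -> (bead_bound q)%:Z < p -> ~~ bead q p.
Proof.
move=> m_gt0; rewrite /bead_bound /bead.
have := coord_bound q `|((p - 1) %% m%:Z)%Z|%N.
move: (coord q _) (\max_(_ < _) _)%N => c M cM pM.
have: M%:Z <= ((p - 1) %/ m%:Z)%Z.
  by rewrite lez_divRL ?ltz_nat //; move: pM; rewrite PoszM; lia.
by move: cM; lia.
Qed.

Definition window (m : nat) (q : 'rV[int]_m) : seq int :=
  [seq (bead_bound q)%:Z - k%:Z | k <- iota 0 (bead_bound q).*2].

(** [lambda_q]; the window is listed in decreasing order, so the parts come out
    weakly decreasing. *)

Definition lam (m : nat) (q : 'rV[int]_m) : seq nat :=
  [seq r <- [seq count (fun p' => (p' < p) && ~~ bead q p') (window q)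
            | p <- window q & bead q p]
   | (0 < r)%N].

(** Type [B_n]. *)

Definition coroot_lattice (n : nat) : set 'rV[int]_n :=
  [set x : 'rV[int]_n | (2 %| \sum_(i < n) x ord0 i)%Z]%classic.

Definition sc_cores (n : nat) : set (seq nat) :=
  [set s : seq nat | [&& is_core n.*2 s, conj_part s == s & ~~ odd (diag_size s)]]%classic.

(** [(x_1, ..., x_n, - x_n, ..., - x_1)]. *)
Definition fold_embed (n : nat) (x : 'rV[int]_n) : 'rV[int]_(n + n) :=
  row_mx x (- \row_(j < n) x ord0 (rev_ord j)).

Definition lamB (n : nat) (x : 'rV[int]_n) : seq nat := lam (fold_embed x).

(** The generators [s_0, ..., s_n] on integer vectors; the column index [k] is
    0-based while [i] is the label of the generator. *)
Definition vec_sB (n : nat) (i : 'I_n.+1) (x : 'rV[int]_n) : 'rV[int]_n :=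
  \row_(k < n)
    if i == 0%N :> nat then
      if k == 0%N :> nat then 1 - coord x 1
      else if k == 1%N :> nat then 1 - coord x 0
      else coord x k
    else if i == n :> nat then
      if k == n.-1 :> nat then - coord x k else coord x k
    else
      if k == i.-1 :> nat then coord x i
      else if k == i :> nat then coord x i.-1
      else coord x k.

Definition core_sB (n : nat) (i : 'I_n.+1) (s : seq nat) : seq nat :=
  let sA := core_sA n.*2 in
  if i == 0%N :> nat then sA 0%N (sA 1%N (sA n.*2.-1 (sA 0%N s)))
  else if i == n :> nat then sA n s
  else sA i (sA (n.*2 - i)%N s).

(** The word [i_1 ... i_r] in the generators stands for [s_{i_1} ... s_{i_r}], of
    which the rightmost letter acts first. *)
Definition word_act (n : nat) (T : Type) (s : 'I_n.+1 -> T -> T)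
    (w : seq 'I_n.+1) (x : T) : T :=
  foldr s x w.

(** Two words represent the same element of the affine Weyl group, viewed as the
    group of affine transformations generated by the [s_i].  Comparison on integer
    vectors suffices, since these affinely span [R^n]. *)
Definition affW_eq (n : nat) (w1 w2 : seq 'I_n.+1) : Prop :=
  word_act (@vec_sB n) w1 =1 word_act (@vec_sB n) w2.

(** The maps [s i] preserve [A] and define an action of the affine Weyl group on
    it: words representing the same element act identically. *)
Definition affW_acts (n : nat) (T : Type) (s : 'I_n.+1 -> T -> T) (A : set T) : Prop :=
  (forall i, set_fun A A (s i)) /\
  (forall w1 w2, affW_eq w1 w2 ->
     forall x, A x -> word_act s w1 x = word_act s w2 x).

Definition affW_equivariant (n : nat) (T U : Type) (s : 'I_n.+1 -> T -> T)
    (t : 'I_n.+1 -> U -> U) (A : set T) (f : T -> U) : Prop :=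
  forall w x, A x -> f (word_act s w x) = word_act t w (f x).

(** The size statistics take values in half-integers, hence in [rat]. *)

Definition pairing (n : nat) (x y : 'rV[rat]_n) : rat :=
  \sum_(k < n) x ord0 k * y ord0 k.

(** [alpha_i] for [1 <= i <= n]; the second term is absent when [i = n]. *)
Definition simple_root (n i : nat) : 'rV[rat]_n :=
  \row_(k < n) ((k == i.-1 :> nat)%:R - (k == i :> nat)%:R).

Definition coweight (n i : nat) : 'rV[rat]_n := \row_(k < n) (k < i)%N%:R.

Definition mark (i : nat) : rat := if (i <= 1)%N then 1 else 2.

Lemma coweight_dual (n i j : nat) : (0 < i <= n)%N -> (0 < j <= n)%N ->
  pairing (simple_root n i) (coweight n j) = (i == j)%:R.
Proof.
move=> /andP[i_gt0 le_in] /andP[j_gt0 le_jn].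
have lt_in : (i.-1 < n)%N by lia.
rewrite /pairing (bigD1 (Ordinal lt_in)) //= !mxE /= eqxx.
have [ltin | lein] := ltnP i n.
  have neq : Ordinal ltin != Ordinal lt_in by rewrite -val_eqE /=; lia.
  rewrite (bigD1 (Ordinal ltin)) //= big1 => [|k /andP[/eqP k1 /eqP k2]]; last first.
    rewrite !mxE; have -> : (k == i.-1 :> nat) = false.
      by apply/eqP => e; apply: k1; apply: val_inj.
    have -> : (k == i :> nat) = false by apply/eqP => e; apply: k2; apply: val_inj.
    by rewrite subrr mul0r.
  rewrite !mxE /= eqxx.
  have -> : (i.-1 == i) = false by lia.
  have -> : (i == i.-1) = false by lia.
  case: (ltngtP i j) => h; have -> : (i.-1 < j)%N = (i <= j)%N by lia.
  - by rewrite ltnW //; lra.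
  - by rewrite leqNgt h /=; lra.
  - by rewrite h leqnn /=; lra.
rewrite big1 => [|k /eqP k1]; last first.
  rewrite !mxE; have -> : (k == i.-1 :> nat) = false.
    by apply/eqP => e; apply: k1; apply: val_inj.
  have -> : (k == i :> nat) = false by have := ltn_ord k; lia.
  by rewrite subrr mul0r.
have -> : (i.-1 == i) = false by lia.
have -> : (i.-1 < j)%N = (i == j) by lia.
by case: (i == j) => /=; lra.
Qed.

Lemma highest_root (n : nat) : (1 < n)%N ->
  \sum_(1 <= i < n.+1) mark i *: simple_root n i = \row_(k < n) (k < 2)%N%:R.
Proof.
move=> n_gt1; apply/rowP => k; rewrite summxE !mxE.
under eq_bigr do rewrite !mxE mulrBr.
rewrite sumrB big_add1 /= (bigD1_seq (k : nat)) ?mem_index_iota ?iota_uniq //=.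
rewrite eqxx big1 => [|i /negPf]; last by rewrite eq_sym => ->; rewrite mulr0.
case: (posnP k) => [k0|k_gt0].
  rewrite big_nat big1 => [|i /andP[i_gt0 _]]; last first.
    have -> : (k == i :> nat) = false by lia.
    by rewrite mulr0.
  by rewrite k0 /mark /=; lra.
have kb : (k : nat) \in index_iota 1 n.+1.
  by rewrite mem_index_iota k_gt0 ltnS ltnW.
rewrite (bigD1_seq (k : nat)) ?iota_uniq //=.
rewrite eqxx big1 => [|i /negPf]; last by rewrite eq_sym => ->; rewrite mulr0.
rewrite /mark; case: (nat_of_ord k) k_gt0 => [|[|l]] //= _; lra.
Qed.

Definition check_size_i (n i : nat) (x : 'rV[int]_n) : rat :=
  let y := map_mx (fun z : int => z%:~R : rat) x in
  pairing ((mark i / 2) *: y - coweight n i) y.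

(** On [lambda = lamB x] the summand [i = n] is [size_n], whereas for [1 < i < n]
    the residues [i] and [2 n - i] are each counted with weight 1/2.  The total is
    therefore [(size - size_0 + size_n) / 2]; it differs from [(size - size_0) / 2]
    as soon as [size_n <> 0], e.g. 7 against 5 for [n = 2] and [x = (-1, -1)],
    where [lambda = (4, 4, 2, 2)]. *)
Definition check_size (n : nat) (x : 'rV[int]_n) : rat :=
  \sum_(0 <= i < n.+1) check_size_i i x.

(* Main.v *)
Require Import Defs.
From mathcomp Require Import zify ring lra.
Import Order.TTheory GRing.Theory Num.Theory.
Set Implicit Arguments.
Unset Strict Implicit.
Unset Printing Implicit Defensive.
Local Open Scope ring_scope.

(** A partition [s] is read off its boundary word: row [u] (from 0) puts a
    bullet at position [beta s u = s_u - u], every other integer carries a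
    circle, and column [v] is the circle at [gap s v = v + 1 - s'_v].  The word,
    given by [maya s], determines [s] ([maya_inj]), and each notion of the
    theorem becomes a statement about words.

    - Hook lengths are distances from a bullet down to a circle, so [s] is an
      [m]-core iff its bullets are stable under [p |-> p - m] ([is_coreP]).  On
      each residue class (runner) the bullets then form a down-set, and the
      heights of these down-sets are a vector [q] with [maya s =1 bead q]
      ([core_bead]); the coordinates of [q] sum to 0 because the bullets of a
      partition are as numerous as those of the empty one ([sum_charge]).
      Conversely [lam q] has the word of [q] ([maya_lam]).
    - Transposition reflects the word by [p |-> 1 - p] and exchanges the two
      letters, so self-conjugate cores are those with [q_{m+1-j} = - q_j]
      ([conj_core_at]), that is, the image of [fold_embed].  Diagonal boxes are
      bullets at positive positions, and there are [sum_k |x_k|] of them, which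
      has the parity of [sum_k x_k] ([odd_diag_fold]).  This is the bijection.
    - On a core, [s_i^A] exchanges the letters at [p] and [p + 1] for all
      [p = i mod m] ([core_sA_maya]), because a core cannot have both addable and
      removable boxes of residue [i].  On [q] this is the usual action
      ([bead_sA]).  Equivariance reduces to identities between vectors, the one
      for [s_0] being [s_0 = r s_1 r], where [r] is [x_1 |-> 1 - x_1] and folds
      onto [s_0^A] ([sB0_conjugate], [fold_reflect0]).  The braid and other group
      relations on cores are then transported from the lattice.
    - The number of boxes of residue [i] in a row telescopes to
      [F (beta s u) - F (- u)] for a step function [F] ([row_res_sum]), so
      [size_i] is a sum over bullets minus the same sum for the empty partition.
      Regrouping bullets by runners ([sum_beta]) turns it into triangular numbers
      and yields [size_i = |q|^2 / 2 - (q_1 + ... + q_i)] ([size_res_bead]).  With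
      [q = (x, - x reversed)] this is [|x|^2 - (x_1 + ... + x_i)] for both residues
      [i] and [2n - i], from which the formulas for [check_size_i] follow. *)

(** * Partitions as weakly decreasing functions *)

Lemma geq_transitive : transitive geq.
Proof. by move=> y x z /= ? ?; lia. Qed.

(** Dropping the zeros of a weakly decreasing list only removes a tail of zeros,
    which the default value of [nth] restores. *)
Lemma nth_trim (s : seq nat) u : sorted geq s ->
  nth 0%N [seq r <- s | (0 < r)%N] u = nth 0%N s u.
Proof.
elim: s u => [|a s IH] u //= as_sorted.
have s_sorted := path_sorted as_sorted.
case: ltnP => [_|a0]; first by case: u => //= u; apply: IH.
have s0 : all (pred1 0%N) s.
  by apply: sub_all (order_path_min geq_transitive as_sorted) => r /=; lia.
have -> : [seq r <- s | (0 < r)%N] = [::].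
  apply/eqP; rewrite -(negbK (_ == _)) -has_filter; apply/hasP => -[r rs r0].
  by move/allP: s0 => /(_ r rs) /=; lia.
rewrite nth_nil; case: u => [|u] /=; first lia.
case: (ltnP u (size s)) => us; last by rewrite nth_default.
by move/allP: s0 => /(_ _ (mem_nth 0%N us)) /= /eqP.
Qed.

Lemma is_partition_trim (s : seq nat) : sorted geq s ->
  is_partition [seq r <- s | (0 < r)%N].
Proof.
move=> s_sorted; rewrite /is_partition mem_filter ltnn /= andbT.
by apply: sorted_filter s_sorted; apply: geq_transitive.
Qed.

Lemma sorted_geq_nth (s : seq nat) :
  (forall u, (nth 0 s u.+1 <= nth 0 s u)%N) -> sorted geq s.
Proof. by move=> h; apply/(sortedP 0%N) => u _; apply: h. Qed.

Lemma partition_nth_leq (s : seq nat) u v :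
  is_partition s -> (u <= v)%N -> (nth 0 s v <= nth 0 s u)%N.
Proof.
case/andP=> s_sorted _ uv.
have [vs|sv] := ltnP v (size s); last by rewrite (nth_default _ sv).
have us := leq_ltn_trans uv vs.
by apply: (sorted_leq_nth geq_transitive) => //; apply: leqnn.
Qed.

Lemma partition_nth_gt0 (s : seq nat) u :
  is_partition s -> (0 < nth 0 s u)%N = (u < size s)%N.
Proof.
case/andP=> _ s0; case: (ltnP u (size s)) => us; last by rewrite nth_default.
by rewrite lt0n; apply: contraNneq s0 => <-; apply: mem_nth.
Qed.

(** * The boundary word of a partition *)

(** The beta-numbers of [s], normalised so that the empty partition occupies the
    positions [p <= 0]; rows beyond the last part continue the sequence by
    [- u]. *)
Definition beta (s : seq nat) (u : nat) : int := (nth 0 s u)%N%:Z - u%:Z.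

(** The bullets of the boundary word (the Maya diagram).  The range makes this a
    boolean: past the last part [beta s u = - u], so a row [u] at position [p]
    satisfies [u < size s] or [u = |p|]. *)
Definition maya (s : seq nat) (p : int) : bool :=
  has (fun u => beta s u == p) (iota 0 (size s + `|p|).+1).

Lemma mayaP s p : reflect (exists u, beta s u = p) (maya s p).
Proof.
apply: (iffP hasP) => [[u _ /eqP] | [u up]]; first by exists u.
exists u; last exact/eqP.
rewrite mem_iota /= add0n; move: up; rewrite /beta.
by case: (ltnP u (size s)) => us; [|rewrite nth_default //]; lia.
Qed.

Lemma maya_beta s u : maya s (beta s u).
Proof. by apply/mayaP; exists u. Qed.

Lemma beta_lt s u v : is_partition s -> (beta s v < beta s u) = (u < v)%N.
Proof.
move=> sP; rewrite /beta; case: (ltnP u v) => uv.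
  by have := partition_nth_leq sP (ltnW uv); lia.
by have := partition_nth_leq sP uv; lia.
Qed.

Lemma beta_inj s : is_partition s -> injective (beta s).
Proof.
move=> sP u v e; have := beta_lt u v sP; have := beta_lt v u sP.
by rewrite e ltxx; lia.
Qed.

(** Both [beta s] and [beta t] are strictly decreasing, and a strictly decreasing
    sequence is determined by its range. *)
Lemma maya_inj s t : is_partition s -> is_partition t ->
  maya s =1 maya t -> s = t.
Proof.
move=> sP tP est.
have le_beta s1 t1 u : is_partition s1 -> is_partition t1 -> maya s1 =1 maya t1 ->
    (forall w, (w < u)%N -> beta s1 w = beta t1 w) -> beta s1 u <= beta t1 u.
  move=> s1P t1P e IH; have := maya_beta s1 u; rewrite e => /mayaP[w wu].
  have [lwu|luw] := ltnP w u; last first.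
    by rewrite -wu leNgt beta_lt // -leqNgt.
  by have := beta_lt w u s1P; rewrite (IH _ lwu) wu ltxx lwu.
have ebeta u : beta s u = beta t u.
  elim/ltn_ind: u => u IH; apply/le_anti; rewrite !le_beta //.
  by move=> w wu; rewrite IH.
have enth u : nth 0%N s u = nth 0%N t u by have := ebeta u; rewrite /beta; lia.
apply: (@eq_from_nth _ 0%N) => [|u _]; last exact: enth.
have e u : (u < size s)%N = (u < size t)%N by rewrite -!partition_nth_gt0 ?enth.
by have := e (size s); have := e (size t); lia.
Qed.

Lemma nth_conj s v : is_partition s ->
  nth 0%N (conj_part s) v = count (fun r => v < r)%N s.
Proof.
move=> sP; rewrite /conj_part; case: (ltnP v (head 0%N s)) => vh.
  by rewrite (nth_map 0%N) ?size_iota // nth_iota.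
rewrite nth_default ?size_map ?size_iota //; apply/esym/eqP.
rewrite -leqn0 leqNgt -has_count; apply/hasP => -[r rs vr].
have := partition_nth_leq sP (leq0n (index r s)).
by rewrite nth_index // nth0; lia.
Qed.

(** Both sides say that the box in row [u] and column [v] belongs to [s].  In this
    form, a Galois connection between [s] and its conjugate, all positions of
    steps can be compared by linear arithmetic. *)
Lemma lt_nth_conj s u v : is_partition s ->
  (u < nth 0 (conj_part s) v)%N = (v < nth 0 s u)%N.
Proof.
move=> sP; rewrite nth_conj //; case/andP: sP => s_sorted _.
elim: s u s_sorted => [|a s IH] u /=; first by rewrite nth_nil !ltn0.
move=> as_sorted; have s_sorted := path_sorted as_sorted.
have s0 : (a <= v)%N -> count (fun r => v < r)%N s = 0%N.
  move=> av; apply/eqP; rewrite -leqn0 leqNgt -has_count; apply/hasP => -[r rs vr].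
  by have /allP/(_ r rs) := order_path_min geq_transitive as_sorted; rewrite /=; lia.
case: u => [|u] /=; last by rewrite -IH //; lia.
by lia.
Qed.

Lemma is_partition_conj s : is_partition s -> is_partition (conj_part s).
Proof.
move=> sP; apply/andP; split.
  apply: sorted_geq_nth => v; rewrite leqNgt; apply/negP => h.
  by have := lt_nth_conj (nth 0%N (conj_part s) v) v sP;
     have := lt_nth_conj (nth 0%N (conj_part s) v) v.+1 sP; lia.
apply/mapP => -[v]; rewrite mem_iota add0n /= => vh e.
have := lt_nth_conj 0 v sP; rewrite nth_conj // -e nth0; lia.
Qed.

(** Position of the right-step of the boundary below column [v]. *)
Definition gap (s : seq nat) (v : nat) : int :=
  v.+1%:Z - (nth 0 (conj_part s) v)%N%:Z.

Lemma beta_conj s v : beta (conj_part s) v = 1 - gap s v.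
Proof. by rewrite /beta /gap; lia. Qed.

Lemma gap_lt_beta s u v : is_partition s ->
  (gap s v < beta s u) = (v < nth 0 s u)%N.
Proof.
by move=> sP; have := lt_nth_conj u v sP; rewrite /gap /beta; lia.
Qed.

(** Row steps and column steps partition the integers.  They are disjoint since
    [s_u + s'_v = u + v + 1] contradicts the Galois connection; for a position [p]
    without a bullet, if [u] is the first row with [beta s u <= p], then the
    circle at [p] comes from column [v = p + u - 1]. *)
Lemma not_mayaP s p : is_partition s ->
  reflect (exists v, gap s v = p) (~~ maya s p).
Proof.
move=> sP; apply: (iffP idP) => [sp|[v <-]]; last first.
  apply/mayaP => -[u e]; have := gap_lt_beta u v sP.
  by have := lt_nth_conj u v sP; move: e; rewrite /beta /gap; lia.
have ex_u : exists u, beta s u <= p.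
  by exists (size s + `|p|)%N; rewrite /beta nth_default; lia.
case: (ex_minnP ex_u) => u up u_min.
have {}up : beta s u < p.
  by rewrite lt_neqAle up andbT; apply: contraNneq sp => <-; apply: maya_beta.
have p_u : 0 < p + u%:Z by move: up; rewrite /beta; lia.
have [v vE] : exists v : nat, v%:Z = p + u%:Z - 1.
  by exists (absz (p + u%:Z - 1)%R); lia.
exists v; have hu := lt_nth_conj u v sP.
have {}u_min : (u <= nth 0 (conj_part s) v)%N.
  case: u u_min up p_u vE {hu} => // u u_min up p_u vE.
  rewrite lt_nth_conj //; have := u_min u; move: up vE; rewrite /beta; lia.
by move: up; rewrite /gap /beta; lia.
Qed.

(** Transposition traverses the boundary backwards and exchanges row steps with
    column steps. *)
Lemma maya_conj s p : is_partition s -> maya (conj_part s) p = ~~ maya s (1 - p).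
Proof.
move=> sP; apply/mayaP/(not_mayaP _ sP) => -[v e]; exists v.
  by rewrite -e beta_conj; lia.
by rewrite beta_conj e; lia.
Qed.

Lemma mem_boxes s b : (b \in boxes s) = (b.2 < nth 0 s b.1)%N.
Proof.
case: b => u v /=; apply/allpairsPdep/idP => [[u' [v' [_ + [-> ->]]]]|uv].
  by rewrite mem_iota.
exists u, v; rewrite !mem_iota !add0n uv /=; split=> //.
by rewrite leqNgt; case: ltnP => // h; rewrite nth_default in uv.
Qed.

(** The hook length of the box [(u, v)] is [beta s u - gap s v], and each bullet
    lying above a circle bounds exactly one box. *)
Lemma is_coreP m s : is_partition s ->
  reflect (forall p, maya s p -> maya s (p - m%:Z)) (is_core m s).
Proof.
move=> sP; rewrite /is_core sP /=; apply: (iffP allP) => [s_core p /mayaP[u up]|s_core].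
  apply/negPn/negP => /(not_mayaP _ sP)[v vp].
  have uv : (v < nth 0 s u)%N.
    rewrite -gap_lt_beta // up vp.
    have [m0|] := posnP m; last by lia.
    have : ~~ maya s p by apply/(not_mayaP _ sP); exists v; rewrite vp m0 subr0.
    by rewrite -up maya_beta.
  have := s_core (u, v); rewrite mem_boxes => /(_ uv) /eqP; case.
  have := lt_nth_conj u v sP; move: up vp; rewrite /beta /gap /hook_length /=; lia.
case=> u v; rewrite mem_boxes /= => uv; apply/eqP => h.
have e : gap s v = beta s u - m%:Z.
  have := lt_nth_conj u v sP; move: h; rewrite /beta /gap /hook_length /=; lia.
have := s_core _ (maya_beta s u); rewrite -e; apply/negP.
by apply/(not_mayaP _ sP); exists v.
Qed.

(** * The generators of the affine symmetric group on cores *)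

Lemma nth_trim_rows (f : nat -> nat) N : (forall u, f u.+1 <= f u)%N ->
  (forall u, (N <= u)%N -> f u = 0%N) ->
  let t := [seq r <- [seq f u | u <- iota 0 N] | (0 < r)%N] in
  is_partition t /\ (forall u, nth 0%N t u = f u).
Proof.
move=> f_le f_0; have nth_f u : nth 0%N [seq f u | u <- iota 0 N] u = f u.
  have [uN|Nu] := ltnP u N; first by rewrite (nth_map 0%N) ?size_iota // nth_iota.
  by rewrite nth_default ?size_map ?size_iota // f_0.
have f_sorted : sorted geq [seq f u | u <- iota 0 N].
  by apply: sorted_geq_nth => u; rewrite !nth_f.
by split=> [|u]; rewrite ?nth_trim //; apply: is_partition_trim.
Qed.

(** An addable box in row [u] has content [beta s u], and adding it moves the
    bullet one step up; this is possible when the next position is free. *)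
Lemma row_addableE m i s u : is_partition s ->
  row_addable m i s u = ~~ maya s (beta s u + 1) && (beta s u == i%:Z %[mod m%:Z])%Z.
Proof.
move=> sP; rewrite /row_addable /has_residue /content /=; congr andb.
apply/idP/idP => [h|].
  apply/mayaP => -[w e]; have lwu : (w < u)%N by rewrite -(beta_lt _ _ sP) e; lia.
  case/predU1P: h => [u0|h]; first by rewrite u0 in lwu.
  have wu : (w <= u.-1)%N by lia.
  by have := partition_nth_leq sP wu; move: e; rewrite /beta; lia.
case: u => [|u] //= h; rewrite ltnNge; apply: contra h => h.
have := partition_nth_leq sP (leqnSn u) => h'.
by apply/mayaP; exists u; move: h h'; rewrite /beta; lia.
Qed.

(** Likewise, removing a box of content [beta s u - 1] moves the bullet one step
    down. *)
Lemma row_removableE m i s u : is_partition s ->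
  row_removable m i s u =
    ~~ maya s (beta s u - 1) && (beta s u - 1 == i%:Z %[mod m%:Z])%Z.
Proof.
move=> sP; rewrite /row_removable /has_residue /content /=.
have -> : (nth 0 s u.+1 < nth 0 s u)%N = ~~ maya s (beta s u - 1).
  apply/idP/idP => [h|]; last first.
    apply: contraR; rewrite -leqNgt => h; apply/mayaP; exists u.+1.
    by have := partition_nth_leq sP (leqnSn u); move: h; rewrite /beta; lia.
  apply/mayaP => -[w e]; have uw : (u < w)%N by rewrite -(beta_lt _ _ sP) e; lia.
  by have := partition_nth_leq sP uw; move: e h; rewrite /beta; lia.
case h: (~~ _) => //=.
have s_gt0 : (0 < nth 0 s u)%N.
  rewrite lt0n; apply: contraTneq h => s0; rewrite negbK; apply/mayaP; exists u.+1.
  by have := partition_nth_leq sP (leqnSn u); rewrite /beta s0; lia.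
by rewrite /beta; congr (_ == _); congr modz; lia.
Qed.

(** The affine transposition exchanging [p] and [p + 1] for all [p] congruent to
    [i]. *)
Definition swap_pos (m i : nat) (p : int) : int :=
  if (p == i%:Z %[mod m%:Z])%Z then p + 1
  else if (p - 1 == i%:Z %[mod m%:Z])%Z then p - 1 else p.

Lemma succ_not_congr (m : nat) (p : int) : (1 < m)%N ->
  (p + 1 == p %[mod m%:Z])%Z = false.
Proof. by move=> m_gt1; rewrite eqz_mod_dvd [p + 1]addrC addrK dvdz1; lia. Qed.

(** The bullets of the new word are those that stay, then those that arrive from
    the position below. *)
Lemma maya_add_rows m i s : is_partition s ->
  let t := [seq r <- [seq (nth 0 s u + row_addable m i s u)%N
                     | u <- iota 0 (size s).+1] | (0 < r)%N] in
  is_partition t /\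
  forall p, maya t p =
    maya s p && ~~ ((p == i%:Z %[mod m%:Z])%Z && ~~ maya s (p + 1))
    || [&& maya s (p - 1), (p - 1 == i%:Z %[mod m%:Z])%Z & ~~ maya s p].
Proof.
move=> sP t; have [||tP t_nth] := nth_trim_rows
    (f := fun u => (nth 0 s u + row_addable m i s u)%N) (N := (size s).+1).
- move=> u; have := partition_nth_leq sP (leqnSn u).
  by rewrite {1}/row_addable /=; case: ltnP => //=; lia.
- move=> u su; rewrite /row_addable (nth_default _ (ltnW su)) nth_default; last by lia.
  by case: eqP => // u0; rewrite u0 in su.
split=> // p; have beta_t u : beta t u =
    if ~~ maya s (beta s u + 1) && (beta s u == i%:Z %[mod m%:Z])%Z
    then beta s u + 1 else beta s u.
  by rewrite -row_addableE // {1}/beta t_nth /beta; case: row_addable; lia.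
apply/mayaP/idP => [[u]|].
  rewrite beta_t; case: ifP => [/andP[np pi] <-|h <-].
    by rewrite addrK maya_beta pi np orbT.
  by rewrite maya_beta andbC [X in ~~ X]andbC h.
case/orP=> [/andP[/mayaP[u up] h]|/and3P[/mayaP[u up] pi np]]; exists u.
  by rewrite beta_t up [X in if X then _ else _]andbC (negbTE h).
by rewrite beta_t up pi subrK np.
Qed.

Lemma maya_remove_rows m i s : is_partition s ->
  let t := [seq r <- [seq (nth 0 s u - row_removable m i s u)%N
                     | u <- iota 0 (size s).+1] | (0 < r)%N] in
  is_partition t /\
  forall p, maya t p =
    maya s p && ~~ ((p - 1 == i%:Z %[mod m%:Z])%Z && ~~ maya s (p - 1))
    || [&& maya s (p + 1), (p == i%:Z %[mod m%:Z])%Z & ~~ maya s p].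
Proof.
move=> sP t; have [||tP t_nth] := nth_trim_rows
    (f := fun u => (nth 0 s u - row_removable m i s u)%N) (N := (size s).+1).
- move=> u; have := partition_nth_leq sP (leqnSn u).
  by rewrite [row_removable m i s u]/row_removable /=; case: ltnP => //=; lia.
- by move=> u su; rewrite nth_default // ltnW.
split=> // p; have beta_t u : beta t u =
    if ~~ maya s (beta s u - 1) && (beta s u - 1 == i%:Z %[mod m%:Z])%Z
    then beta s u - 1 else beta s u.
  rewrite -row_removableE // {1}/beta t_nth /beta.
  by case h: row_removable; [case/andP: h => h _|]; lia.
apply/mayaP/idP => [[u]|].
  rewrite beta_t; case: ifP => [/andP[np pi] <-|h <-].
    by rewrite subrK maya_beta pi np orbT.
  by rewrite maya_beta andbC [X in ~~ X]andbC h.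
case/orP=> [/andP[/mayaP[u up] h]|/and3P[/mayaP[u up] pi np]]; exists u.
  by rewrite beta_t up [X in if X then _ else _]andbC (negbTE h).
by rewrite beta_t up addrK pi np.
Qed.

Lemma maya_closed m s p k : is_core m s -> maya s p -> maya s (p - (k * m)%N%:Z).
Proof.
move=> s_core sp; have sP : is_partition s by case/andP: s_core.
have /(is_coreP _ sP) s_down := s_core.
elim: k => [|k IH]; first by rewrite mul0n subr0.
by rewrite mulSnr PoszD opprD addrA; apply: s_down.
Qed.

Lemma maya_closed_mod m s p p' : (0 < m)%N -> is_core m s -> (p' == p %[mod m%:Z])%Z ->
  p' <= p -> maya s p -> maya s p'.
Proof.
move=> m_gt0 s_core; rewrite eq_sym eqz_mod_dvd => /dvdzP[k e] p'p /(maya_closed `|k| s_core).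
suff -> : p - (`|k| * m)%N%:Z = p' by [].
have k_ge0 : 0 <= k by rewrite -(pmulr_lge0 _ (_ : 0 < m%:Z)) // -e subr_ge0.
by rewrite PoszM gez0_abs // -e subKr.
Qed.

(** If some box of residue [i] is addable, there are a bullet at [p0] and a circle
    at [p0 + 1], with [p0 = i mod m].  Since bullets are stable under [p |-> p - m]
    and circles under [p |-> p + m], a bullet at [p + 1] then forces one at [p] for
    every [p = i mod m], so that moving bullets up wherever possible exchanges the
    letters at [p] and [p + 1].  If no box is addable, the reverse implication
    holds and moving bullets down has the same effect. *)
Lemma core_sA_maya m i s : (1 < m)%N -> is_core m s ->
  is_partition (core_sA m i s) /\ maya (core_sA m i s) =1 maya s \o swap_pos m i.
Proof.
move=> m_gt1 s_core; have sP : is_partition s by case/andP: s_core.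
have no_both p : (p == i%:Z %[mod m%:Z])%Z -> (p - 1 == i%:Z %[mod m%:Z])%Z -> False.
  move=> /eqP <-; rewrite eq_sym -{1}[p](subrK 1); apply/negP.
  by rewrite succ_not_congr.
rewrite /core_sA; case: ifP => [/hasP[u _]|no_add].
  rewrite row_addableE // => /andP[nu ui].
  have up p : (p == i%:Z %[mod m%:Z])%Z -> maya s (p + 1) -> maya s p.
    move=> pi sp; have [le_p|lt_p] := lerP p (beta s u).
      apply: maya_closed_mod (ltnW m_gt1) s_core _ le_p (maya_beta s u).
      by rewrite (eqP pi) (eqP ui).
    case/negP: nu; apply: maya_closed_mod (ltnW m_gt1) s_core _ _ sp; last by lia.
    by rewrite -modzDml (eqP ui) -(eqP pi) modzDml.
  have [tP t_maya] := maya_add_rows m i sP; split=> // p.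
  rewrite t_maya /swap_pos /=; case: ifP => pi.
    have -> : (p - 1 == i%:Z %[mod m%:Z])%Z = false by apply/negP => /(no_both p pi).
    by have := up p pi; rewrite andbF orbF /= negbK; do 2 case: maya => //; move=> ->.
  case: ifP => p1i; last by rewrite andbF orbF andbT.
  have := up _ p1i; rewrite subrK /= andbT; do 2 case: maya => //; by move=> ->.
have up p : (p == i%:Z %[mod m%:Z])%Z -> maya s p -> maya s (p + 1).
  move=> pi /mayaP[u up]; apply/negPn/negP => np.
  move/negP: no_add; apply; apply/hasP; exists u; last by rewrite row_addableE // up np.
  rewrite mem_iota /= add0n ltnS leqNgt; apply: contra np => su.
  apply/mayaP; exists u.-1; rewrite -up /beta !nth_default; lia.
have [tP t_maya] := maya_remove_rows m i sP; split=> // p.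
rewrite t_maya /swap_pos /=; case: ifP => pi.
  have -> : (p - 1 == i%:Z %[mod m%:Z])%Z = false by apply/negP => /(no_both p pi).
  by have := up p pi; rewrite /= andbT; do 2 case: maya => //; move=> ->.
case: ifP => p1i; last by rewrite andbF orbF andbT.
have := up _ p1i; rewrite subrK /= andbF orbF negbK; do 2 case: maya => //; by move=> ->.
Qed.

Lemma swap_posB m i p : swap_pos m i (p - m%:Z) = swap_pos m i p - m%:Z.
Proof.
have shift r : ((r - m%:Z) %% m%:Z)%Z = (r %% m%:Z)%Z.
  by rewrite -[in RHS](modzMDl (-1)) mulN1r addrC.
rewrite /swap_pos (addrAC p _ (-1)) (shift p) (shift (p - 1)).
by case: ifP => _; last case: ifP => _ //; rewrite addrAC.
Qed.

Lemma core_sA_core m i s : (1 < m)%N -> is_core m s -> is_core m (core_sA m i s).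
Proof.
move=> m_gt1 s_core; have [tP t_maya] := core_sA_maya i m_gt1 s_core.
have sP : is_partition s by case/andP: s_core.
apply/is_coreP => // p; rewrite !t_maya /= swap_posB.
by move: (swap_pos m i p); apply/is_coreP.
Qed.

(** * Bullets grouped by runners *)

(** [window q] is [win (bead_bound q)]; larger windows are needed to see at once
    the rows of a partition and the levels of a vector. *)
Definition win (N : nat) : seq int := [seq N%:Z - k%:Z | k <- iota 0 N.*2].

Lemma mem_win N p : (p \in win N) = (- N%:Z < p <= N%:Z).
Proof.
apply/mapP/idP => [[k]|pN]; first by rewrite mem_iota; lia.
by exists (absz (N%:Z - p)%R); rewrite ?mem_iota; lia.
Qed.

Lemma win_uniq N : uniq (win N).
Proof. by rewrite map_inj_uniq ?iota_uniq // => k l; lia. Qed.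

Lemma size_win N : size (win N) = N.*2.
Proof. by rewrite size_map size_iota. Qed.

Lemma nth_win N k : (k < N.*2)%N -> nth 0 (win N) k = N%:Z - k%:Z.
Proof. by move=> kN; rewrite (nth_map 0%N) ?size_iota // nth_iota. Qed.

Lemma gt_int_trans : transitive (>%R : rel int).
Proof. by move=> y x z /= xy yz; apply: lt_trans yz xy. Qed.

Lemma win_sorted N : sorted >%R (win N).
Proof.
apply/(sortedP 0) => k; rewrite size_win => kN /=.
by rewrite !nth_win //; lia.
Qed.

(** For [N] large enough, the bullets in the window are those of the first [N]
    rows, as many as for the empty partition: a partition has charge 0. *)
Lemma perm_beta_win s N : is_partition s -> (size s <= N)%N -> (head 0 s <= N)%N ->
  perm_eq [seq beta s u | u <- iota 0 N] [seq p <- win N | maya s p].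
Proof.
move=> sP sN hN; apply: uniq_perm.
- by rewrite map_inj_uniq ?iota_uniq //; apply: beta_inj.
- by rewrite filter_uniq ?win_uniq.
move=> p; rewrite mem_filter mem_win; apply/mapP/idP => [[u + ->]|/andP[/mayaP[u up] pN]].
  rewrite mem_iota maya_beta; have := partition_nth_leq sP (leq0n u).
  by rewrite nth0 /beta; lia.
exists u => //; rewrite mem_iota /=; move: up pN; rewrite /beta.
by case: (ltnP u N) => // Nu; rewrite nth_default; lia.
Qed.

Lemma bead_runner m (q : 'rV[int]_m) (l : int) (b : nat) : (b < m)%N ->
  bead q (m%:Z * l + b%:Z + 1) = (l < coord q b).
Proof.
move=> bm; rewrite /bead addrK mulrC divzMDl ?modzMDl; last by lia.
by rewrite divz_small ?modz_small // addr0 lezD1.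
Qed.

(** With [l] and [b] numbered from 0, this is the decomposition
    [p = m (l' - 1) + j] for [l' = l + 1] and [j = b + 1]. *)
Lemma runnerP m (p : int) : (0 < m)%N ->
  exists l : int, exists2 b : nat, (b < m)%N & p = m%:Z * l + b%:Z + 1.
Proof.
move=> m_gt0; exists ((p - 1) %/ m%:Z)%Z.
have m_pos : 0 < m%:Z by [].
have bm := ltz_pmod (p - 1) m_pos.
have b_ge0 := modz_ge0 (p - 1) (lt0r_neq0 m_pos).
exists (absz ((p - 1) %% m%:Z)%Z); first by lia.
by rewrite gez0_abs // mulrC -divz_eq subrK.
Qed.

Lemma coord_ord m (q : 'rV[int]_m) (b : 'I_m) : coord q b = q ord0 b.
Proof. by rewrite /coord valK. Qed.

Lemma perm_win_runners m K : (0 < m)%N ->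
  perm_eq (win (m * K))
    [seq m%:Z * (a%:Z - K%:Z) + (b : 'I_m)%:Z + 1
    | b <- index_enum 'I_m, a <- iota 0 K.*2].
Proof.
move=> m_gt0; apply: uniq_perm; first exact: win_uniq.
  apply: allpairs_uniq; rewrite ?index_enum_uniq ?iota_uniq //.
  move=> [b a] [b' a'] _ _ /= e; have := ltn_ord b; have := ltn_ord b' => b'm bm.
  have e1 : m%:Z * a%:Z + b%:Z = m%:Z * a'%:Z + b'%:Z by lia.
  have {}e1 : (a * m + b)%N = (a' * m + b')%N by lia.
  have ea : a = a'.
    by have := congr1 (divn ^~ m) e1; rewrite /= !divnMDl // !divn_small // !addn0.
  by congr pair => //; apply: val_inj; move: e1; rewrite /= ea => /addnI.
move=> p; rewrite mem_win; apply/idP/allpairsP => [pK|[[b a] [_]]].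
  have [l [b bm e]] := runnerP p m_gt0.
  exists (Ordinal bm, absz (l + K%:Z)%R); split; first by rewrite mem_index_enum.
    by rewrite mem_iota /=; nia.
  by rewrite /= e; nia.
rewrite mem_iota /= => aK ->; have := ltn_ord b; nia.
Qed.

(** On runner [b] the bullets of the window [win (m * K)] have levels
    [l = a - K] for [0 <= a < K + q_b]. *)
Lemma sum_bead_win (V : nmodType) m K (q : 'rV[int]_m) (G : int -> V) : (0 < m)%N ->
  (forall j, `|q ord0 j| <= K)%N ->
  \sum_(p <- win (m * K) | bead q p) G p =
  \sum_(b < m) \sum_(0 <= a < absz (K%:Z + q ord0 b)%R)
     G (m%:Z * (a%:Z - K%:Z) + b%:Z + 1).
Proof.
move=> m_gt0 qK; rewrite big_mkcond /= (perm_big _ (perm_win_runners K m_gt0)) /=.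
rewrite big_allpairs_dep /=; apply: eq_bigr => b _.
rewrite (big_nat_widen _ _ K.*2); last by have := qK b; lia.
rewrite [RHS]big_mkcond /= /index_iota subn0.
apply: eq_bigr => a _; rewrite bead_runner // coord_ord.
by congr (if _ then _ else _); have := qK b; lia.
Qed.

Lemma count_bead_win m K (q : 'rV[int]_m) : (0 < m)%N ->
  (forall j, `|q ord0 j| <= K)%N ->
  (count (bead q) (win (m * K)))%:Z = (m * K)%N%:Z + \sum_(j < m) q ord0 j.
Proof.
move=> m_gt0 qK; rewrite -sum1_count -natz natr_sum.
rewrite (sum_bead_win (fun=> 1%:R) m_gt0 qK).
rewrite (eq_bigr (fun b : 'I_m => K%:Z + q ord0 b)) => [|b _].
  by rewrite big_split /= sumr_const card_ord -mulr_natr natz PoszM mulrC.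
by rewrite sumr_const_nat subn0 natz; have := qK b; lia.
Qed.

(** [K] is large enough for [win (m * K)] to see all the nontrivial part of both
    [s] and [q]. *)
Definition fits m (K : nat) (s : seq nat) (q : 'rV[int]_m) : Prop :=
  [/\ (size s <= K)%N, (head 0 s <= K)%N & forall j, (`|q ord0 j| <= K)%N].

Lemma fits_large m s (q : 'rV[int]_m) :
  fits (size s + head 0 s + \max_(j < m) `|q ord0 j|)%N s q.
Proof.
split=> [||j]; try by lia.
apply: leq_trans (leq_addl _ _); exact: (leq_bigmax (F := fun j => `|q ord0 j|%N)).
Qed.

Lemma perm_beta_bead m s (q : 'rV[int]_m) K : (0 < m)%N ->
  is_partition s -> maya s =1 bead q -> fits K s q ->
  perm_eq [seq beta s u | u <- iota 0 (m * K)] [seq p <- win (m * K) | bead q p].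
Proof.
move=> m_gt0 sP e [sK hK _]; rewrite -(eq_filter e).
have mK : (K <= m * K)%N by rewrite leq_pmull.
by apply: perm_beta_win => //; apply: leq_trans mK.
Qed.

(** The tool by which the statistics of a core are computed from [q]: [G] is the
    indicator of [0 < p] for the diagonal, and a step function for the number of
    boxes of given residue. *)
Lemma sum_beta (V : nmodType) m s (q : 'rV[int]_m) K (G : int -> V) : (0 < m)%N ->
  is_partition s -> maya s =1 bead q -> fits K s q ->
  \sum_(0 <= u < m * K) G (beta s u) =
  \sum_(b < m) \sum_(0 <= a < absz (K%:Z + q ord0 b)%R)
     G (m%:Z * (a%:Z - K%:Z) + b%:Z + 1).
Proof.
move=> m_gt0 sP e sK; rewrite -sum_bead_win //; last by case: sK.
rewrite -[RHS]big_filter -(perm_big _ (perm_beta_bead m_gt0 sP e sK)) /=.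
by rewrite big_map /index_iota subn0.
Qed.

Lemma sum_charge m s (q : 'rV[int]_m) : (0 < m)%N ->
  is_partition s -> maya s =1 bead q -> \sum_(j < m) q ord0 j = 0.
Proof.
move=> m_gt0 sP e; have sK := fits_large s q; move: (_ + _)%N sK => K sK.
have := perm_size (perm_beta_bead m_gt0 sP e sK).
rewrite size_filter size_map size_iota => /(congr1 Posz).
rewrite count_bead_win //; last by case: sK.
by rewrite -{1}[_%:Z]addr0 => /addrI.
Qed.

(** * From vectors to cores and back *)

Lemma count_lt_nth (L : seq int) u : sorted >%R L -> (u < size L)%N ->
  count (fun p => p < nth 0 L u) L = (size L - u.+1)%N.
Proof.
elim: L u => [|x L IH] u //= xL; have L_lt := order_path_min gt_int_trans xL.
have L_sorted := path_sorted xL.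
case: u => [|u] /=.
  by move=> _; rewrite ltxx add0n subn1 /=; apply/eqP; rewrite -all_count.
rewrite ltnS => uL; rewrite IH // subSS.
have lt_x : nth 0 L u < x := allP L_lt _ (mem_nth 0 uL).
by rewrite (lt_gtF lt_x).
Qed.

Lemma lam_partition m (q : 'rV[int]_m) : is_partition (lam q).
Proof.
apply: is_partition_trim; rewrite sorted_map.
apply: sub_sorted (sorted_filter gt_int_trans _ (win_sorted _)) => p p' /= pp'.
by apply: sub_count => r /= /andP[rp' ->]; rewrite andbT (lt_trans rp').
Qed.

(** Let [p] be the bullet of index [u] in the window, of half-width [B].  Of the
    [p + B - 1] positions of the window below [p], [B - u - 1] carry bullets, as
    the window contains [B] bullets in all when [q] sums to 0.  So [p + u] circles
    remain, and the part of [lam q] given by [p] has beta-number [p]. *)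
Lemma maya_lam m (q : 'rV[int]_m) : (0 < m)%N -> \sum_(j < m) q ord0 j = 0 ->
  maya (lam q) =1 bead q.
Proof.
move=> m_gt0 q0; pose B := bead_bound q; pose L := [seq p <- window q | bead q p].
have L_sorted : sorted >%R L.
  exact: (sorted_filter gt_int_trans (bead q) (win_sorted B)).
(* Since [q] sums to 0, exactly half of the window carries bullets. *)
have sizeL : size L = B.
  have := @count_bead_win m (\max_(j < m) `|q ord0 j|)%N q m_gt0.
  rewrite -[win _]/(window q) -size_filter -/L q0 addr0 => cL; apply/eqP.
  by rewrite -eqz_nat cL // => j; apply: (leq_bigmax (F := fun j => `|q ord0 j|%N)).
have nth_lam u : nth 0%N (lam q) u =
    nth 0%N [seq count (fun p' => (p' < p) && ~~ bead q p') (window q) | p <- L] u.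
  rewrite nth_trim // sorted_map; apply: sub_sorted L_sorted => p p' /= pp'.
  by apply: sub_count => r /= /andP[rp' ->]; rewrite andbT (lt_trans rp').
have beta_lo u : (u < B)%N -> beta (lam q) u = nth 0 L u.
  move=> uB; rewrite /beta nth_lam (nth_map 0) ?sizeL //; set p := nth 0 L u.
  have : p \in L by rewrite mem_nth ?sizeL.
  rewrite mem_filter => /andP[_ pW].
  have := count_lt_nth L_sorted (u := u); rewrite sizeL -/p => /(_ uB) cL.
  have cW : count (fun p' => p' < p) (window q) = (B.*2 - (index p (window q)).+1)%N.
    rewrite -(size_win B) -[win B]/(window q).
    by rewrite -{1}(nth_index 0 pW) count_lt_nth ?index_mem //; apply: win_sorted.
  have ip : p = B%:Z - (index p (window q))%:Z.
    rewrite -{1}(nth_index 0 pW) nth_win //.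
    by rewrite -(size_win B) index_mem.
  have iW : (index p (window q) < B.*2)%N by rewrite -(size_win B) index_mem.
  have split_count : (count (fun p' : int => (p' < p)%R && ~~ bead q p') (window q)
      + count (fun p' : int => (p' < p)%R) L
      = count (fun p' : int => (p' < p)%R) (window q))%N.
    rewrite count_filter; elim: (window q) => //= r W <-.
    by rewrite addnACA; case: (r < p); case: (bead q r).
  move: split_count; rewrite cL cW; move: (count _ _) => c.
  by clear cW cL; move: (index _ _) ip iW => k; clearbody p => ip iW cE; lia.
have beta_hi u : (B <= u)%N -> beta (lam q) u = - u%:Z.
  by move=> Bu; rewrite /beta nth_lam nth_default ?sub0r // size_map sizeL.
move=> p; apply/mayaP/idP => [[u <-]|qp].
  case: (ltnP u B) => uB; last by rewrite beta_hi // bead_low //; lia.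
  have : nth 0 L u \in L by rewrite mem_nth ?sizeL.
  by rewrite beta_lo // mem_filter => /andP[].
have [pB|Bp] := lerP p (- B%:Z).
  by exists `|p|%N; rewrite beta_hi; lia.
have pL : p \in L.
  rewrite mem_filter qp -[window q]/(win B) mem_win Bp /= leNgt.
  by apply: contraL qp => /(bead_high m_gt0).
exists (index p L); rewrite beta_lo ?nth_index //.
by rewrite -sizeL index_mem.
Qed.

Lemma maya_low s p : p <= - (size s)%:Z -> maya s p.
Proof. by move=> ps; apply/mayaP; exists `|p|%N; rewrite /beta nth_default; lia. Qed.

Lemma maya_high s p : is_partition s -> (head 0%N s)%:Z < p -> ~~ maya s p.
Proof.
move=> sP hp; apply/mayaP => -[u]; have := partition_nth_leq sP (leq0n u).
by rewrite nth0 /beta; lia.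
Qed.

Lemma runner_level (P : pred int) (N : nat) :
  (forall l l' : int, l' <= l -> P l -> P l') -> P (- N%:Z) -> ~~ P N%:Z ->
  exists c : int, forall l, P l = (l < c).
Proof.
move=> P_down P_low P_high.
have ex_k : exists k : nat, ~~ P (k%:Z - N%:Z).
  by exists N.*2; apply: contra P_high; apply: P_down; lia.
case: (ex_minnP ex_k) => k Pk k_min; exists (k%:Z - N%:Z) => l.
have [lk|kl] := ltrP l (k%:Z - N%:Z); last by apply/negbTE; apply: contra Pk; apply: P_down.
have [lN|Nl] := lerP l (- N%:Z); first exact: P_down P_low.
apply/negPn/negP => nPl; have := k_min (absz (l + N%:Z)%R).
have -> : (absz (l + N%:Z))%:Z - N%:Z = l by lia.
by move=> /(_ nPl); lia.
Qed.

(** [q_b] is the height of the down-set of bullets on runner [b]. *)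
Lemma core_bead m s : (0 < m)%N -> is_core m s ->
  exists q : 'rV[int]_m, maya s =1 bead q.
Proof.
move=> m_gt0 s_core; have sP : is_partition s by case/andP: s_core.
have level (b : 'I_m) :
    exists c : int, forall l, maya s (m%:Z * l + b%:Z + 1) = (l < c).
  apply: (@runner_level (fun l => maya s (m%:Z * l + b%:Z + 1)) (size s + head 0%N s).+1).
  - move=> l l' ll'; apply: maya_closed_mod m_gt0 s_core _ _; last by nia.
    by rewrite -!addrA ![m%:Z * _]mulrC !modzMDl.
  - by apply: maya_low; have := ltn_ord b; nia.
  - by apply: maya_high => //; nia.
have [c cP] := fin_all_exists level; exists (\row_b c b) => p.
have [l [b bm ->]] := runnerP p m_gt0.
by rewrite bead_runner // (coord_ord _ (Ordinal bm)) mxE -cP.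
Qed.

Lemma bead_inj m (q q' : 'rV[int]_m) : bead q =1 bead q' -> q = q'.
Proof.
move=> e; apply/rowP => b; rewrite -!coord_ord; apply/eqP.
have el l : (l < coord q b) = (l < coord q' b).
  by rewrite -!bead_runner.
by have := el (coord q b); have := el (coord q' b); lia.
Qed.

(** * Sizes *)

(** Rows past the last one contribute nothing, so that [N] can be chosen as the
    bound of a window. *)
Lemma count_boxes (a : pred (nat * nat)) s N : (size s <= N)%N ->
  count a (boxes s) =
  (\sum_(0 <= u < N) \sum_(0 <= v < nth 0 s u) a (u, v))%N.
Proof.
move=> sN; rewrite -sum1_count big_mkcond /boxes big_allpairs_dep /=.
rewrite (@big_cat_nat _ _ _ (size s)) //= [X in (_ + X)%N]big_nat.
rewrite [X in (_ + X)%N]big1 => [|u /andP[su _]]; last first.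
  by rewrite nth_default // big_geq.
rewrite addn0 /index_iota subn0; apply: eq_bigr => u _; rewrite subn0.
by apply: eq_bigr => v _; case: (a _).
Qed.

(** Row [u] meets the diagonal iff [u < s_u]. *)
Lemma diag_size_beta s N : (size s <= N)%N ->
  diag_size s = (\sum_(0 <= u < N) (0 < beta s u)%R)%N.
Proof.
move=> sN; rewrite /diag_size (count_boxes _ sN); apply: eq_bigr => u _ /=.
have [us|su] := ltnP u (nth 0%N s u).
  rewrite (bigD1_seq u) ?mem_index_iota ?iota_uniq //= eqxx big1 => [|v].
    by rewrite /beta; lia.
  by rewrite eq_sym => /negbTE ->.
rewrite big_nat big1 => [|v /andP[_ vs]]; first by rewrite /beta; lia.
by apply/eqP; rewrite eqb0; lia.
Qed.

Lemma sum_step_nat (K N : nat) : (\sum_(0 <= a < N) (K <= a) = N - K)%N.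
Proof.
elim: N => [|N IH]; first by rewrite big_geq.
by rewrite big_nat_recr //= IH; lia.
Qed.

Lemma diag_size_bead m s (q : 'rV[int]_m) : (0 < m)%N ->
  is_partition s -> maya s =1 bead q ->
  diag_size s = (\sum_(b < m) absz (Num.max 0 (q ord0 b))%R)%N.
Proof.
move=> m_gt0 sP e; have sK := fits_large s q; move: (_ + _)%N sK => K sK.
have [sizeK _ qK] := sK.
have mK : (K <= m * K)%N by rewrite leq_pmull.
rewrite (diag_size_beta (leq_trans sizeK mK)).
rewrite (sum_beta (V := nat) (fun p => nat_of_bool (0 < p)) m_gt0 sP e sK).
apply: eq_bigr => b _.
have pos a : (0 < m%:Z * (a%:Z - K%:Z) + b%:Z + 1) = (K <= a)%N.
  by have := ltn_ord b; nia.
rewrite (eq_bigr (fun a => nat_of_bool (K <= a)%N)) => [|a _]; last by rewrite pos.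
by rewrite [LHS]sum_step_nat; have := qK b; lia.
Qed.

Lemma divz_step (m : nat) (a : int) : (0 < m)%N ->
  (a %/ m%:Z)%Z - ((a - 1) %/ m%:Z)%Z = (m%:Z %| a)%Z :> int.
Proof.
move=> m_gt0; have [l [b bm e]] := runnerP a m_gt0.
have e1 : a - 1 = l * m%:Z + b%:Z by rewrite e addrK mulrC.
have m0 : m%:Z != 0 by lia.
have small (c : nat) : (c < m)%N -> ((l * m%:Z + c%:Z) %/ m%:Z)%Z = l.
  by move=> cm; rewrite divzMDl // divz_small ?addr0 //; lia.
rewrite e1 small //; have [bm1|bm1] := ltnP b.+1 m.
  have -> : a = l * m%:Z + b.+1%:Z by lia.
  rewrite small // subrr; case: dvdz_mod0P => //.
  by rewrite modzMDl modz_small //; lia.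
have -> : a = (l + 1) * m%:Z by nia.
by rewrite mulzK // dvdz_mull //; lia.
Qed.

(** The contents of row [u] run from [- u] to [beta s u - 1]; by [divz_step] the
    count of those congruent to [i] telescopes. *)
Lemma row_res_sum m i u r : (0 < m)%N ->
  (\sum_(0 <= v < r) has_residue m i (u, v))%N%:Z =
  ((r%:Z - u%:Z - 1 - i%:Z) %/ m%:Z)%Z - ((- u%:Z - 1 - i%:Z) %/ m%:Z)%Z.
Proof.
move=> m_gt0; elim: r => [|r IH]; first by rewrite big_geq // sub0r subrr.
rewrite big_nat_recr //= PoszD IH /has_residue /content /= eqz_mod_dvd -divz_step //.
have -> : r%:Z - u%:Z - i%:Z - 1 = r%:Z - u%:Z - 1 - i%:Z by lia.
have -> : r.+1%:Z - u%:Z - 1 - i%:Z = r%:Z - u%:Z - i%:Z by lia.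
by lia.
Qed.

Lemma sum_runner_ceil (K N : nat) (d : int) :
  2 * \sum_(0 <= a < N) (a%:Z - K%:Z - d) = N%:Z * (N%:Z - 1) - 2 * (K%:Z + d) * N%:Z.
Proof.
elim: N => [|N IH]; first by rewrite big_geq // !mulr0 mul0r subrr.
rewrite big_nat_recr //= mulrDr IH; lia.
Qed.

(** Runner [b] contributes the sum of [a - K - [b < i]] over [0 <= a < K + q_b],
    minus the same sum for [q = 0].  Twice this is [q_b^2 - q_b - 2 [b < i] q_b],
    independently of [K], and the linear terms [q_b] cancel because [q] sums
    to 0. *)
Lemma size_res_bead m i s (q : 'rV[int]_m) : (i < m)%N ->
  is_partition s -> maya s =1 bead q ->
  2 * (size_res m i s)%:Z =
  \sum_(b < m) q ord0 b ^+ 2 - 2 * \sum_(b < m | (b < i)%N) q ord0 b.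
Proof.
move=> im sP e; have m_gt0 : (0 < m)%N by apply: leq_ltn_trans im.
have sK := fits_large s q; move: (_ + _)%N sK => K sK; have [sizeK _ qK] := sK.
have mK : (K <= m * K)%N by rewrite leq_pmull.
(* Counts, up to a constant, the integers below [p] congruent to [i] mod [m]. *)
pose F (p : int) : int := ((p - 1 - i%:Z) %/ m%:Z)%Z.
have sizeE : (size_res m i s)%:Z =
    \sum_(0 <= u < m * K) F (beta s u) - \sum_(0 <= u < m * K) F (beta [::] u).
  rewrite -sumrB /size_res (count_boxes _ (leq_trans sizeK mK)) -natz natr_sum.
  apply: eq_bigr => u _; rewrite natz row_res_sum //.
  by rewrite /F /beta nth_nil sub0r.
(* The vacuum terms [F (- u)] are those of the empty partition, with [q = 0]. *)
have e0 : maya [::] =1 bead (0 : 'rV[int]_m).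
  move=> p; have [l [b bm ->]] := runnerP p m_gt0; rewrite bead_runner //.
  rewrite (coord_ord _ (Ordinal bm)) mxE; apply/idP/idP => h.
    by rewrite ltNge; apply: contraL h => l0; apply: maya_high => //=; nia.
  by apply: maya_low => /=; nia.
have s0K : fits K [::] (0 : 'rV[int]_m) by split=> // j; rewrite mxE.
rewrite sizeE (sum_beta F m_gt0 sP e sK) (sum_beta F m_gt0 (isT : is_partition [::]) e0 s0K).
(* Residue [i] is met one level later on the runners [b < i]. *)
have FE b a : (b < m)%N ->
    F (m%:Z * (a%:Z - K%:Z) + b%:Z + 1) = a%:Z - K%:Z - (b < i)%N%:Z.
  move=> bm; rewrite /F addrK.
  have m0 : m%:Z != 0 by lia.
  case: ltnP => bi.
    have -> : m%:Z * (a%:Z - K%:Z) + b%:Z - i%:Z =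
       (a%:Z - K%:Z - 1) * m%:Z + (m + b - i)%N%:Z by lia.
    by rewrite divzMDl // divz_small ?addr0 //; lia.
  have -> : m%:Z * (a%:Z - K%:Z) + b%:Z - i%:Z =
     (a%:Z - K%:Z) * m%:Z + (b - i)%N%:Z by lia.
  by rewrite divzMDl // divz_small ?addr0 ?subr0 //; lia.
have runner b (c : int) : (b < m)%N -> (`|c| <= K)%N ->
    2 * \sum_(0 <= a < absz (K%:Z + c)%R) F (m%:Z * (a%:Z - K%:Z) + b%:Z + 1) =
    (K%:Z + c) * (K%:Z + c - 1) - 2 * (K%:Z + (b < i)%N%:Z) * (K%:Z + c).
  move=> bm cK; rewrite (eq_bigr _ (fun a _ => FE b a bm)) sum_runner_ceil.
  by rewrite gez0_abs //; lia.
rewrite mulrBr !mulr_sumr -!sumrB.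
have -> : \sum_(b < m) q ord0 b ^+ 2 =
    \sum_(b < m) q ord0 b ^+ 2 - \sum_(b < m) q ord0 b.
  by rewrite (sum_charge m_gt0 sP e) subr0.
rewrite -sumrB [X in _ = _ - X]big_mkcond -sumrB; apply: eq_bigr => b _.
rewrite !runner ?mxE ?qK //.
case: ltnP => _ /=; rewrite expr2; ring.
Qed.

(** Each box has exactly one residue. *)
Lemma psize_res m s : (0 < m)%N -> psize s = (\sum_(0 <= i < m) size_res m i s)%N.
Proof.
move=> m_gt0; rewrite /psize -count_predT -sum1_count.
rewrite (eq_bigr (fun i => \sum_(b <- boxes s) (has_residue m i b : nat))%N); last first.
  by move=> i _; rewrite /size_res -sum1_count big_mkcond.
rewrite exchange_big /=; apply: eq_bigr => b _.
have m0 : m%:Z != 0 by lia.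
have := modz_ge0 (content b) m0; have := ltz_pmod (content b) (_ : 0 < m%:Z).
move=> /(_ m_gt0); case e : (content b %% m%:Z)%Z => [k|] // km _.
rewrite (bigD1_seq k) ?mem_index_iota ?iota_uniq //= big_nat_cond big1 => [|j].
  by rewrite /has_residue e modz_small ?eqxx //; lia.
case/andP => /andP[_ jm] jk; rewrite /has_residue e modz_small; last by lia.
by rewrite eqz_nat eq_sym (negbTE jk).
Qed.

(** * Generators acting on lattice vectors *)

Definition lattice_sA m (i : nat) (q : 'rV[int]_m) : 'rV[int]_m :=
  \row_(b < m)
    if i == 0%N then
      if b == 0%N :> nat then coord q m.-1 + 1
      else if b == m.-1 :> nat then coord q 0 - 1
      else coord q b
    else
      if b == i.-1 :> nat then coord q i
      else if b == i :> nat then coord q i.-1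
      else coord q b.

Lemma coord_sA m i (q : 'rV[int]_m) (b : nat) : (b < m)%N ->
  coord (lattice_sA i q) b =
    if i == 0%N then
      if b == 0%N then coord q m.-1 + 1
      else if b == m.-1 then coord q 0 - 1 else coord q b
    else if b == i.-1 then coord q i
    else if b == i then coord q i.-1 else coord q b.
Proof. by move=> bm; rewrite (coord_ord _ (Ordinal bm)) mxE. Qed.

(** For [0 < i] the positions [p] and [p + 1] lie at the same level of two
    neighbouring runners; for [i = 0] they lie on the last and first runners, one
    level apart, hence the shifts by 1. *)
Lemma bead_sA m i (q : 'rV[int]_m) : (1 < m)%N -> (i < m)%N ->
  bead (lattice_sA i q) =1 bead q \o swap_pos m i.
Proof.
move=> m_gt1 im p; have m_gt0 := ltnW m_gt1.
have [l [b bm ->]] := runnerP p m_gt0.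
rewrite bead_runner // coord_sA //= /swap_pos addrK.
have res (l' : int) (c : nat) : (c < m)%N ->
    (m%:Z * l' + c%:Z == i%:Z %[mod m%:Z])%Z = (c == i).
  by move=> cm; rewrite mulrC modzMDl !modz_small //; lia.
rewrite res //.
have -> : (m%:Z * l + b%:Z + 1 == i%:Z %[mod m%:Z])%Z =
          if b.+1 == m then i == 0%N else b.+1 == i.
  case: (b.+1 =P m) => bm1; last first.
    have -> : m%:Z * l + b%:Z + 1 = m%:Z * l + b.+1%:Z by lia.
    by rewrite res //; lia.
  have -> : m%:Z * l + b%:Z + 1 = m%:Z * (l + 1) + 0%N%:Z by lia.
  by rewrite res // eq_sym.
case: (eqVneq i 0%N) => [->|i0].
  case: (b.+1 =P m) => bm1.
    have -> : (b == 0%N) = false by lia.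
    have -> : (b == m.-1) by lia.
    have -> : m%:Z * l + b%:Z + 1 + 1 = m%:Z * (l + 1) + 0%N%:Z + 1 by lia.
    by rewrite bead_runner //; lia.
  have -> : (b == m.-1) = false by lia.
  case: (eqVneq b 0%N) => b0 /=; last by rewrite bead_runner.
  have -> : m%:Z * l + b%:Z = m%:Z * (l - 1) + m.-1%:Z + 1 by lia.
  by rewrite bead_runner; lia.
have -> : (if b.+1 == m then false else b.+1 == i) = (b == i.-1) by case: (b.+1 =P m); lia.
case: (eqVneq b i.-1) => bi.
  have -> : m%:Z * l + b%:Z + 1 + 1 = m%:Z * l + i%:Z + 1 by lia.
  by rewrite bead_runner.
case: (eqVneq b i) => bi'; last by rewrite bead_runner.
have -> : m%:Z * l + b%:Z = m%:Z * l + i.-1%:Z + 1 by lia.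
by rewrite bead_runner //; lia.
Qed.

Definition core_at m (s : seq nat) (q : 'rV[int]_m) : Prop :=
  is_core m s /\ maya s =1 bead q.

Lemma core_at_sA m i s (q : 'rV[int]_m) : (1 < m)%N -> (i < m)%N ->
  core_at s q -> core_at (core_sA m i s) (lattice_sA i q).
Proof.
move=> m_gt1 im [s_core e]; split; first exact: core_sA_core.
move=> p; have [_ ->] := core_sA_maya i m_gt1 s_core.
by rewrite bead_sA //=.
Qed.

Lemma core_at_inj m s t (q : 'rV[int]_m) : core_at s q -> core_at t q -> s = t.
Proof.
move=> [/andP[sP _] es] [/andP[tP _] et]; apply: maya_inj => // p.
by rewrite es et.
Qed.

Lemma core_at_lam m (q : 'rV[int]_m) : (0 < m)%N -> \sum_(j < m) q ord0 j = 0 ->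
  core_at (lam q) q.
Proof.
move=> m_gt0 q0; have e := maya_lam m_gt0 q0; split=> //.
apply/is_coreP => [|p]; first exact: lam_partition.
rewrite !e; have [l [b bm ->]] := runnerP p m_gt0.
have -> : m%:Z * l + b%:Z + 1 - m%:Z = m%:Z * (l - 1) + b%:Z + 1 by lia.
by rewrite !bead_runner //; lia.
Qed.

(** * Folding: from type A to type B *)

Lemma coord_fold n (x : 'rV[int]_n) b : (b < n + n)%N ->
  coord (fold_embed x) b = if (b < n)%N then coord x b else - coord x (n + n - b.+1)%N.
Proof.
move=> bn; rewrite (coord_ord _ (Ordinal bn)) /fold_embed mxE.
case: splitP => j /= ->; first by rewrite ltn_ord coord_ord.
rewrite ltnNge leq_addr /= !mxE -coord_ord /=.
by congr (- coord x _); lia.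
Qed.

Lemma sum_fold n (V : nmodType) (F : int -> V) (x : 'rV[int]_n) :
  \sum_(b < n + n) F (fold_embed x ord0 b) =
  \sum_(k < n) F (x ord0 k) + \sum_(k < n) F (- x ord0 k).
Proof.
rewrite big_split_ord /=; congr (_ + _); first by apply: eq_bigr => k _; rewrite row_mxEl.
rewrite [RHS](reindex_inj rev_ord_inj) /=; apply: eq_bigr => k _.
by rewrite row_mxEr !mxE.
Qed.

Lemma fold_sum0 n (x : 'rV[int]_n) : \sum_(b < n + n) fold_embed x ord0 b = 0.
Proof. by rewrite (sum_fold id) sumrN subrr. Qed.

Lemma core_at_lamB n (x : 'rV[int]_n) : (0 < n)%N -> core_at (lamB x) (fold_embed x).
Proof. by move=> n_gt0; apply: core_at_lam; [lia | exact: fold_sum0]. Qed.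

Lemma fold_inj n : injective (@fold_embed n).
Proof. by move=> x y; rewrite /fold_embed => /eq_row_mx[]. Qed.

Lemma coord_sB n (i : 'I_n.+1) (x : 'rV[int]_n) (k : nat) : (k < n)%N ->
  coord (vec_sB i x) k =
    if i == 0%N :> nat then
      if k == 0%N then 1 - coord x 1
      else if k == 1%N then 1 - coord x 0
      else coord x k
    else if i == n :> nat then
      if k == n.-1 then - coord x k else coord x k
    else
      if k == i.-1 then coord x i
      else if k == i :> nat then coord x i.-1
      else coord x k.
Proof. by move=> kn; rewrite (coord_ord _ (Ordinal kn)) mxE. Qed.

(** The affine reflection [x_1 |-> 1 - x_1], the generator [s_0] of type C.  It
    does not preserve the coroot lattice of type B, but conjugates [s_1] into the
    generator [s_0] of type B, see [sB0_conjugate]; it folds onto [s_0^A]. *)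
Definition reflect0 n (x : 'rV[int]_n) : 'rV[int]_n :=
  \row_(k < n) if k == 0%N :> nat then 1 - coord x 0 else coord x k.

Lemma coord_reflect0 n (x : 'rV[int]_n) (k : nat) : (k < n)%N ->
  coord (reflect0 x) k = if k == 0%N then 1 - coord x 0 else coord x k.
Proof. by move=> kn; rewrite (coord_ord _ (Ordinal kn)) mxE. Qed.

Lemma eq_coord m (q q' : 'rV[int]_m) :
  (forall b, (b < m)%N -> coord q b = coord q' b) -> q = q'.
Proof. by move=> e; apply/rowP => b; rewrite -!coord_ord e. Qed.

Lemma fold_reflect0 n (x : 'rV[int]_n) : (0 < n)%N ->
  fold_embed (reflect0 x) = lattice_sA 0 (fold_embed x).
Proof.
move=> n_gt0; apply: eq_coord => b bn; rewrite coord_sA // coord_fold //=.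
rewrite !coord_fold; [|lia..]; rewrite n_gt0.
have [->|b0] := eqVneq b 0%N.
  rewrite n_gt0 coord_reflect0 //=; have -> : ((n + n).-1 < n)%N = false by lia.
  have -> : (n + n - (n + n).-1.+1)%N = 0%N by lia.
  by rewrite addrC.
case: ltnP => bn'; rewrite coord_reflect0; try lia.
  by rewrite (negbTE b0); have -> : (b == (n + n).-1) = false by lia.
have -> : (n + n - b.+1 == 0)%N = (b == (n + n).-1) by lia.
by case: eqP => _; rewrite ?opprB.
Qed.

Lemma fold_negate_last n (x : 'rV[int]_n) : (0 < n)%N ->
  fold_embed (vec_sB ord_max x) = lattice_sA n (fold_embed x).
Proof.
move=> n_gt0; apply: eq_coord => b bn.
rewrite coord_sA // !coord_fold; [|lia..]; have -> : (n == 0)%N = false by lia.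
have -> : (n.-1 < n)%N by lia.
have e : (n + n - n.+1)%N = n.-1 by lia.
rewrite ltnn e; case: ltnP => bn'; rewrite coord_sB ?eqxx; try lia.
  have -> : (n == 0)%N = false by lia.
  have -> : (b == n) = false by lia.
  by case: eqP => // ->.
have -> : (n == 0)%N = false by lia.
have -> : (b == n.-1) = false by lia.
have -> : (n + n - b.+1 == n.-1)%N = (b == n) by lia.
by case: eqP => // ->; rewrite opprK e.
Qed.

Lemma fold_swap n (i : 'I_n.+1) (x : 'rV[int]_n) : (0 < i < n)%N ->
  fold_embed (vec_sB i x) = lattice_sA i (lattice_sA (n + n - i) (fold_embed x)).
Proof.
move=> /andP[i_gt0 iN]; apply: eq_coord => b bn.
have i0 : (i == 0 :> nat)%N = false by lia.
have j0 : (n + n - i == 0 :> nat)%N = false by lia.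
have iN' : (i == n :> nat)%N = false by lia.
(* [s_{2n-i}^A] moves only the second half of the folded vector. *)
have low c : (c < n)%N -> coord (lattice_sA (n + n - i) (fold_embed x)) c = coord x c.
  move=> cn; rewrite coord_sA ?j0 ?coord_fold ?cn; [|lia..].
  have -> : (c == (n + n - i).-1) = false by lia.
  by have -> : (c == (n + n - i)%N) = false by lia.
rewrite coord_sA // coord_fold // i0; case: ltnP => bn'; rewrite coord_sB ?i0 ?iN'; try lia.
  by rewrite !low //; lia.
have -> : (b == i.-1) = false by lia.
have -> : (b == i) = false by lia.
rewrite coord_sA // j0 !coord_fold; [|lia..].
have -> : (n + n - b.+1 == i.-1)%N = (b == n + n - i)%N by lia.
have -> : (n + n - b.+1 == i)%N = (b == (n + n - i).-1)%N by lia.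
have -> : (n + n - i < n)%N = false by lia.
have -> : ((n + n - i).-1 < n)%N = false by lia.
have -> : (b < n)%N = false by lia.
have -> : (n + n - (n + n - i).+1)%N = i.-1 by lia.
have -> : (n + n - (n + n - i).-1.+1)%N = i by lia.
by case: (b =P (n + n - i)%N) => b1; case: (b =P (n + n - i).-1) => b2 //; lia.
Qed.

(** Explains the word [s_0^A s_1^A s_{2n-1}^A s_0^A]: the two inner letters fold
    [s_1] and the outer ones fold [reflect0]. *)
Lemma sB0_conjugate n (i1 : 'I_n.+1) (x : 'rV[int]_n) : (1 < n)%N -> i1 = 1%N :> nat ->
  vec_sB ord0 x = reflect0 (vec_sB i1 (reflect0 x)).
Proof.
move=> n_gt1 e1; have n0 : (1 == n)%N = false by lia.
apply: eq_coord => k kn; rewrite coord_sB // coord_reflect0 //=.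
rewrite !coord_sB; [|lia..]; rewrite e1 n0 /= !coord_reflect0 //; [|lia..].
by case: k kn => [|[|k]].
Qed.

Lemma core_at_sB n (i : 'I_n.+1) s (x : 'rV[int]_n) : (1 < n)%N ->
  core_at s (fold_embed x) -> core_at (core_sB i s) (fold_embed (vec_sB i x)).
Proof.
move=> n_gt1 sx; rewrite /core_sB -addnn.
have n_gt0 := ltnW n_gt1; have generator j t (q : 'rV[int]_(n + n)) : (j < n + n)%N ->
  core_at t q -> core_at (core_sA (n + n) j t) (lattice_sA j q).
  by apply: core_at_sA; lia.
case: (eqVneq (i : nat) 0%N) => [i0|i0].
  have -> : i = ord0 by apply: val_inj.
  rewrite (@sB0_conjugate _ (inord 1)) ?inordK // fold_reflect0 // fold_swap ?inordK //.
  rewrite fold_reflect0 // subn1.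
  by do 4 (apply: (generator); first by lia).
case: (eqVneq (i : nat) n) => [iN|iN].
  have -> : i = ord_max by apply: val_inj.
  by rewrite fold_negate_last //; apply: generator => //; lia.
have iN' : (0 < i < n)%N by have := ltn_ord i; lia.
by rewrite fold_swap //; do 2 (apply: (generator); first by lia).
Qed.

(** Each generator changes at most two coordinates, and changes their sum by an
    even number. *)
Lemma coroot_lattice_sB n (i : 'I_n.+1) (x : 'rV[int]_n) : (1 < n)%N ->
  coroot_lattice x -> coroot_lattice (vec_sB i x).
Proof.
move=> n_gt1; rewrite /coroot_lattice /=; have iN := ltn_ord i.
have change2 (a b : nat) (y : 'rV[int]_n) : (a < b < n)%N ->
    (forall k, (k < n)%N -> k != a -> k != b -> coord y k = coord x k) ->
    \sum_(k < n) y ord0 k - \sum_(k < n) x ord0 k =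
    coord y a + coord y b - coord x a - coord x b.
  move=> /andP[ab bn] e; have an := ltn_trans ab bn.
  rewrite -sumrB (bigD1 (Ordinal an)) //= (bigD1 (Ordinal bn)) /=; last first.
    by rewrite -val_eqE /=; lia.
  rewrite big1 => [|k /andP[ka kb]]; last by rewrite -!coord_ord e ?subrr.
  by rewrite -!coord_ord /=; lia.
suff : exists d : int, \sum_(k < n) vec_sB i x ord0 k - \sum_(k < n) x ord0 k = 2 * d.
  case=> d e xL; rewrite -(subrK (\sum_(k < n) x ord0 k) (\sum_(k < n) _)) e.
  by apply: rpredD xL; apply: dvdz_mulr.
case: (eqVneq (i : nat) 0%N) => [i0|i0].
  exists (1 - coord x 0 - coord x 1); rewrite (change2 0%N 1%N) //.
    by rewrite !coord_sB ?i0 //=; lia.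
  by move=> k kn /negbTE k0 /negbTE k1; rewrite coord_sB // i0 /= k0 k1.
case: (eqVneq (i : nat) n) => [i_n|i_n].
  exists (- coord x n.-1); rewrite (change2 0%N n.-1); try lia.
    rewrite !coord_sB; try lia; rewrite (negbTE i0) i_n !eqxx.
    have -> : (0 == n.-1)%N = false by lia.
    by lia.
  by move=> k kn _ /negbTE k1; rewrite coord_sB // (negbTE i0) i_n eqxx k1.
exists 0; rewrite (change2 i.-1 i); try lia.
  rewrite !coord_sB; try lia; rewrite (negbTE i0) (negbTE i_n) !eqxx.
  have -> : (i == i.-1 :> nat) = false by lia.
  by lia.
move=> k kn /negbTE k0 /negbTE k1.
by rewrite coord_sB // (negbTE i0) (negbTE i_n) k0 k1.
Qed.

(** The reflection [p |-> 1 - p] exchanges runners [b] and [m - 1 - b] and reverses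
    levels. *)
Lemma conj_core_at m s (q : 'rV[int]_m) : (0 < m)%N -> core_at s q ->
  conj_part s = s <-> (forall b, (b < m)%N -> coord q (m - b.+1)%N = - coord q b).
Proof.
move=> m_gt0 [s_core e]; have sP : is_partition s by case/andP: s_core.
have reflect_pos (l : int) (b : nat) : (b < m)%N ->
    1 - (m%:Z * l + b%:Z + 1) = m%:Z * (- l - 1) + (m - b.+1)%N%:Z + 1.
  by lia.
split=> [se b bm|qN].
  have el l : (- l - 1 < coord q (m - b.+1)%N) = ~~ (l < coord q b).
    rewrite -bead_runner; last by lia.
    rewrite -reflect_pos // -(bead_runner q l bm) -!e.
    by rewrite -[in LHS]se maya_conj // subKr.
  by have := el (coord q b); have := el (coord q b - 1); lia.
apply: maya_inj => [||p] //; first exact: is_partition_conj.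
rewrite maya_conj // !e; have [l [b bm ->]] := runnerP p m_gt0.
by rewrite reflect_pos // !bead_runner //; [rewrite qN //; lia | lia].
Qed.

(** Positive bullets number [max 0 q_b] on runner [b]; the runners of [x_k] and
    [- x_k] together contribute [|x_k|]. *)
Lemma odd_diag_fold n s (x : 'rV[int]_n) : (0 < n)%N -> core_at s (fold_embed x) ->
  odd (diag_size s) = ~~ (2 %| \sum_(k < n) x ord0 k)%Z.
Proof.
move=> n_gt0 [s_core e]; have sP : is_partition s by case/andP: s_core.
rewrite (diag_size_bead _ sP e); last by lia.
rewrite (sum_fold (V := nat) (fun z => absz (Num.max 0 z))) -big_split /=.
have -> : forall z : int, ~~ (2 %| z)%Z = odd `|z|.
  by move=> z; rewrite dvdzE dvdn2 negbK.
elim/big_rec2: _ => // k a z _; lia.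
Qed.

Lemma sc_core_at n s : (0 < n)%N -> sc_cores n s ->
  exists2 x : 'rV[int]_n, coroot_lattice x & core_at s (fold_embed x).
Proof.
move=> n_gt0 /and3P[s_core /eqP s_conj s_diag].
have m_gt0 : (0 < n + n)%N by lia.
have [q e] : exists q : 'rV[int]_(n + n), maya s =1 bead q.
  by apply: core_bead; rewrite ?addnn // -addnn.
have sq : core_at s q by split; rewrite // addnn.
have /(conj_core_at m_gt0 sq) qN := s_conj.
pose x : 'rV[int]_n := \row_k coord q k.
have qx : q = fold_embed x.
  have coord_x k : (k < n)%N -> coord x k = coord q k.
    by move=> kn; rewrite (coord_ord _ (Ordinal kn)) mxE.
  apply: eq_coord => b bn; rewrite coord_fold //.
  case: ltnP => bn'; rewrite coord_x //; try lia.
  by rewrite qN // opprK.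
rewrite qx in sq; exists x => //.
by have := odd_diag_fold n_gt0 sq; rewrite (negbTE s_diag) => /esym/negbFE.
Qed.

Lemma lamB_sc n (x : 'rV[int]_n) : (0 < n)%N -> coroot_lattice x -> sc_cores n (lamB x).
Proof.
move=> n_gt0 xL; have sx := core_at_lamB x n_gt0; apply/and3P; split.
- by rewrite -addnn; case: sx.
- apply/eqP/(conj_core_at _ sx) => [|b bn]; first by lia.
  rewrite !coord_fold //; last by lia.
  case: (ltnP b n) => bn'.
    have -> : (n + n - b.+1 < n)%N = false by lia.
    by congr (- coord x _); lia.
  have -> : (n + n - b.+1 < n)%N by lia.
  by rewrite opprK.
by rewrite (odd_diag_fold n_gt0 sx) negbK.
Qed.

Lemma sum_prefix_fold n i (x : 'rV[int]_n) : (i <= n)%N ->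
  \sum_(b < n + n | (b < i)%N) fold_embed x ord0 b = \sum_(k < n | (k < i)%N) x ord0 k.
Proof.
move=> iN; rewrite big_mkcond big_split_ord /= [X in _ + X]big1 ?addr0 => [|k _].
  by rewrite [RHS]big_mkcond; apply: eq_bigr => k _; rewrite row_mxEl.
by case: ltnP => //; lia.
Qed.

(** The coordinates of [fold_embed x] with indices [i <= b < n + n - i] cancel in
    pairs. *)
Lemma sum_prefix_fold_sym n i (x : 'rV[int]_n) : (i <= n)%N ->
  \sum_(b < n + n | (b < n + n - i)%N) fold_embed x ord0 b =
  \sum_(k < n | (k < i)%N) x ord0 k.
Proof.
move=> iN; rewrite big_mkcond big_split_ord /= [X in _ + X](reindex_inj rev_ord_inj) /=.
rewrite [RHS]big_mkcond -big_split /=; apply: eq_bigr => k _; have := ltn_ord k => kn.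
rewrite row_mxEl row_mxEr !mxE rev_ordK.
have -> : (k < n + n - i)%N by lia.
have -> : (n + (n - k.+1) < n + n - i)%N = ~~ (k < i)%N by lia.
by case: (k < i)%N; rewrite /= ?addr0 ?subrr.
Qed.

(** The residues [i] and [2n - i] have equally many boxes, by self-conjugacy; here
    this is visible from the formula. *)
Lemma size_res_lamB n i (x : 'rV[int]_n) : (0 < n)%N -> (i <= n)%N ->
  let c := \sum_(k < n) x ord0 k ^+ 2 - \sum_(k < n | (k < i)%N) x ord0 k in
  (size_res n.*2 i (lamB x))%:Z = c /\
  ((0 < i)%N -> (size_res n.*2 (n.*2 - i) (lamB x))%:Z = c).
Proof.
move=> n_gt0 iN; have [s_core e] := core_at_lamB x n_gt0.
have sP : is_partition (lamB x) by case/andP: s_core.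
have sq : \sum_(b < n + n) fold_embed x ord0 b ^+ 2 = 2 * \sum_(k < n) x ord0 k ^+ 2.
  rewrite (sum_fold (fun z => z ^+ 2)) [X in _ + X](eq_bigr (fun k => x ord0 k ^+ 2)).
    by rewrite mulr2n mulrDl mul1r.
  by move=> k _; rewrite sqrrN.
have half (a b c : int) : 2 * a = 2 * b - 2 * c -> a = b - c by lia.
rewrite /= -addnn; split=> [|i_gt0]; apply: half; rewrite (size_res_bead _ sP e) ?sq.
- by rewrite sum_prefix_fold.
- by lia.
- by rewrite sum_prefix_fold_sym.
- by lia.
Qed.

Lemma check_size_iE n i (x : 'rV[int]_n) :
  check_size_i i x = mark i / 2 * (\sum_(k < n) x ord0 k ^+ 2)%:~R
                     - (\sum_(k < n | (k < i)%N) x ord0 k)%:~R.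
Proof.
rewrite /check_size_i /pairing !rmorph_sum /= mulr_sumr [X in _ = _ - X]big_mkcond -sumrB.
apply: eq_bigr => k _; rewrite !mxE rmorphXn /= expr2 mulrBl.
by rewrite mulrA; case: ltnP => _; rewrite ?mul1r ?mul0r.
Qed.

(** * The theorem *)

Theorem theorem5p3 (n : nat) (n_ge2 : (2 <= n)%N) :
  [/\ affW_acts (@vec_sB n) (@coroot_lattice n),
      affW_acts (@core_sB n) (@sc_cores n),
      set_bij (@coroot_lattice n) (@sc_cores n) (@lamB n),
      affW_equivariant (@vec_sB n) (@core_sB n) (@coroot_lattice n) (@lamB n)
    & forall x : 'rV[int]_n, @coroot_lattice n x ->
        let sz := fun i : nat => (size_res n.*2 i (lamB x))%:R : rat in
        (forall i : nat, (i <= n)%N ->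
           check_size_i i x =
             1 / 2 * (if (1 < i)%N then sz i + sz (n.*2 - i)%N
                      else if i == 1%N then sz 1%N + sz n.*2.-1 - sz 0%N
                      else sz 0%N)) /\
        check_size x = 1 / 2 * ((psize (lamB x))%:R - sz 0%N + sz n)].
Proof.
have n_gt0 := ltnW n_ge2.
have vec_lattice i x : coroot_lattice x -> coroot_lattice (@vec_sB n i x).
  exact: coroot_lattice_sB.
(* Both sides are cores with the coordinates [fold_embed (vec_sB i x)]. *)
have equiv1 i (x : 'rV[int]_n) : core_sB i (lamB x) = lamB (vec_sB i x).
  apply: core_at_inj (core_at_lamB _ n_gt0).
  by apply: core_at_sB => //; apply: core_at_lamB.
have equiv w (x : 'rV[int]_n) :
    lamB (word_act (@vec_sB n) w x) = word_act (@core_sB n) w (lamB x).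
  by elim: w => //= i w <-; rewrite equiv1.
have lamB_surj s : sc_cores n s -> exists2 x : 'rV[int]_n, coroot_lattice x & lamB x = s.
  move=> /(sc_core_at n_gt0)[x xL sx]; exists x => //.
  exact: core_at_inj (core_at_lamB x n_gt0) sx.
split.
- by split=> // w1 w2 w12 x _; rewrite w12.
(* Stability and group relations on cores come from those on the lattice, along
   the equivariant surjection [lamB]. *)
- split=> [i s|w1 w2 w12 s] /lamB_surj[x xL <-].
    by rewrite equiv1; apply: lamB_sc => //; apply: vec_lattice.
  by rewrite -!equiv w12.
- split=> [x xL|x y _ _ exy|s /lamB_surj[x xL xs]]; first exact: lamB_sc.
    apply/fold_inj/bead_inj => p.
    have [_ <-] := core_at_lamB x n_gt0; have [_ <-] := core_at_lamB y n_gt0.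
    by rewrite exy.
  by exists x.
- by move=> w x _; apply: equiv.
move=> x xL sz.
have szE i : (i <= n)%N ->
    sz i = (\sum_(k < n) x ord0 k ^+ 2)%:~R - (\sum_(k < n | (k < i)%N) x ord0 k)%:~R.
  move=> iN; have [e _] := size_res_lamB x n_gt0 iN.
  by rewrite /sz pmulrn e rmorphB.
have szNE i : (0 < i <= n)%N -> sz (n.*2 - i)%N = sz i.
  move=> /andP[i_gt0 iN]; have [e /(_ i_gt0) e'] := size_res_lamB x n_gt0 iN.
  by rewrite /sz !pmulrn e e'.
have prefix0 : \sum_(k < n | (k < 0)%N) x ord0 k = 0 by rewrite big_pred0.
have sizes i : (i <= n)%N -> check_size_i i x =
    1 / 2 * (if (1 < i)%N then sz i + sz (n.*2 - i)%N
             else if i == 1%N then sz 1%N + sz n.*2.-1 - sz 0%N else sz 0%N).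
  case: i => [|[|i]] iN; rewrite check_size_iE /mark /=.
  - by rewrite szE // prefix0; lra.
  - by rewrite -[n.*2.-1]subn1 szNE // (szE 0%N) // (szE 1%N) // prefix0; lra.
  by rewrite szNE ?szE //; lra.
split=> //; rewrite /check_size.
have total : (psize (lamB x))%:R = \sum_(0 <= i < n.*2) sz i :> rat.
  by rewrite (psize_res (m := n.*2)) ?natr_sum //; lia.
have n2 : (n <= n.*2)%N by lia.
rewrite (big_cat_nat (leq0n n) n2) /= in total.
(* The residues [n, ..., 2n - 1] are [2n - i] for [1 <= i <= n]; together with
   [0, ..., n] they cover everything, [n] being counted twice. *)
have upper : \sum_(n <= i < n.*2) sz i = \sum_(1 <= i < n.+1) sz (n.*2 - i)%N.
  rewrite big_nat_rev /= -{1}[n]add0n big_addn -addnn addnK big_add1 /=.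
  by apply: eq_bigr => i _; congr sz; lia.
have rest : \sum_(2 <= i < n.+1) check_size_i i x =
    1 / 2 * (\sum_(2 <= i < n.+1) sz i + \sum_(2 <= i < n.+1) sz (n.*2 - i)%N).
  rewrite -big_split mulr_sumr; apply: eq_big_nat => i /andP[i_gt1 iN].
  by rewrite sizes // i_gt1.
rewrite total upper.
have lower : \sum_(0 <= i < n) sz i + sz n =
    sz 0%N + sz 1%N + \sum_(2 <= i < n.+1) sz i.
  by rewrite -big_nat_recr //= big_ltn // big_ltn ?addrA //; lia.
have peel (F : nat -> rat) : \sum_(1 <= i < n.+1) F i = F 1%N + \sum_(2 <= i < n.+1) F i.
  by rewrite big_ltn.
rewrite [LHS]big_ltn // !peel rest !sizes //= subn1; move: lower; lra.
Qed.
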